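(* Let $p,m\ge1$ and $q>1$ be integers. If $p+q+m$ is even, then the three (alternating) quadratic Euler $R$-sums $$R_{mp,q}=\sum_{n=0}^\infty \frac{H_{n}^{(m)}H_{n}^{(p)}}{(n+1/2)^q},\quad R_{m\bar p,q}=\sum_{n=0}^\infty \frac{H_{n}^{(m)}\bar H_{n}^{(p)}}{(n+1/2)^q},\quad R_{\bar m\bar p,q}=\sum_{n=0}^\infty \frac{\bar H_{n}^{(m)}\bar H_{n}^{(p)}}{(n+1/2)^q}$$ are reducible to (alternating) linear $R$-sums. If $p+q+m$ is odd, then the three (alternating) quadratic Euler $R$-sums $$R_{mp,\bar q}=\sum_{n=0}^\infty \frac{H_{n}^{(m)}H_{n}^{(p)}}{(n+1/2)^q}(-1)^{n},\quad R_{m\bar p,\bar q}=\sum_{n=0}^\infty \frac{H_{n}^{(m)}\bar H_{n}^{(p)}}{(n+1/2)^q}(-1)^{n},\quad R_{\bar m\bar p,\bar q}=\sum_{n=0}^\infty \frac{\bar H_{n}^{(m)}\bar H_{n}^{(p)}}{(n+1/2)^q}(-1)^{n}$$ are reducible to (alternating) linear $R$-sums.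
   Context: $H_n^{(p)}=\sum_{k=1}^n k^{-p}$ and $\bar H_n^{(p)}=\sum_{k=1}^n(-1)^{k-1}k^{-p}$ (both $0$ for $n=0$). The (alternating) linear $R$-sums are, for integers $a\ge1$, $b\ge2$, $$\sum_{n=0}^\infty\frac{H_n^{(a)}}{(n+1/2)^b},\quad \sum_{n=0}^\infty\frac{\bar H_n^{(a)}}{(n+1/2)^b},\quad \sum_{n=0}^\infty\frac{H_n^{(a)}(-1)^n}{(n+1/2)^b},\quad \sum_{n=0}^\infty\frac{\bar H_n^{(a)}(-1)^n}{(n+1/2)^b}.$$ Single values: $\zeta(k)=\sum_{n\ge1}n^{-k}$ and $R(k)=\sum_{n\ge1}(n-1/2)^{-k}$ for $k\ge2$, $R(1):=2\log2$; $\zeta(\bar k)=\sum_{n\ge1}(-1)^nn^{-k}$ and $R(\bar k)=\sum_{n\ge1}(-1)^n(n-1/2)^{-k}$ for $k\ge1$. A number is called reducible to (alternating) linear $R$-sums if it is a polynomial with rational coefficients in (alternating) linear $R$-sums and the single values $\zeta(k),\zeta(\bar k),R(k),R(\bar k)$. *)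

(* Defs.v *)
From HB Require Import structures.
From mathcomp Require Import all_boot all_order all_algebra.
From mathcomp Require Import -(notations) mpoly.
From mathcomp Require Import all_classical all_reals all_analysis.

Set Implicit Arguments.
Unset Strict Implicit.
Unset Printing Implicit Defensive.

Import Order.TTheory GRing.Theory Num.Theory.
Import numFieldNormedType.Exports.

Local Open Scope classical_set_scope.
Local Open Scope ring_scope.

Definition H (R : realType) (p n : nat) : R :=
  \sum_(1 <= k < n.+1) (k%:R ^+ p)^-1.

Definition Hbar (R : realType) (p n : nat) : R :=
  \sum_(1 <= k < n.+1) (-1) ^+ k.-1 / k%:R ^+ p.

Definition zeta (R : realType) (k : nat) : R :=
  \big[+%R/0]_(1 <= n <oo) ((n%:R : R) ^+ k)^-1.

Definition zetabar (R : realType) (k : nat) : R :=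
  \big[+%R/0]_(1 <= n <oo) ((-1) ^+ n / (n%:R : R) ^+ k).

(* The defining series diverges at k = 1, where the value is set by
   convention. *)
Definition Rval (R : realType) (k : nat) : R :=
  if k == 1%N then 2 * ln 2
  else \big[+%R/0]_(1 <= n <oo) ((n%:R - 2^-1 : R) ^+ k)^-1.

Definition Rbar (R : realType) (k : nat) : R :=
  \big[+%R/0]_(1 <= n <oo) ((-1) ^+ n / (n%:R - 2^-1 : R) ^+ k).

Definition Rterm (R : realType) (f : nat -> R) (b n : nat) : R :=
  f n / (n%:R + 2^-1) ^+ b.

Definition Rsum (R : realType) (f : nat -> R) (b : nat) : R :=
  \big[+%R/0]_(0 <= n <oo) Rterm f b n.

Inductive linear_Rsum (R : realType) : R -> Prop :=
| Linear_H a b of (1 <= a)%N & (2 <= b)%N :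
    linear_Rsum (Rsum (fun n => H R a n) b)
| Linear_Hbar a b of (1 <= a)%N & (2 <= b)%N :
    linear_Rsum (Rsum (fun n => Hbar R a n) b)
| Linear_H_alt a b of (1 <= a)%N & (2 <= b)%N :
    linear_Rsum (Rsum (fun n => H R a n * (-1) ^+ n) b)
| Linear_Hbar_alt a b of (1 <= a)%N & (2 <= b)%N :
    linear_Rsum (Rsum (fun n => Hbar R a n * (-1) ^+ n) b).

Inductive single_value (R : realType) : R -> Prop :=
| Single_zeta k of (2 <= k)%N : single_value (zeta R k)
| Single_zetabar k of (1 <= k)%N : single_value (zetabar R k)
| Single_R k of (1 <= k)%N : single_value (Rval R k)
| Single_Rbar k of (1 <= k)%N : single_value (Rbar R k).

(* mpoly N rat is {mpoly rat[N]}, whose notations clash with those of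
   MathComp-Analysis; mmap ratr v P is the value of P at the point v. *)
Definition reducible (R : realType) (x : R) : Prop :=
  exists (N : nat) (v : 'I_N -> R) (P : mpoly N rat),
    (forall i, linear_Rsum (v i) \/ single_value (v i)) /\
    x = mmap (ratr : rat -> R) v P.

(* [Rsum] is a total limit operator; convergence is what gives it its
   meaning as the value of the series. *)
Definition Rsum_reducible (R : realType) (f : nat -> R) (b : nat) : Prop :=
  cvgn (series (Rterm f b)) /\ reducible (Rsum f b).

(* Main.v *)
Require Import Defs.
From HB Require Import structures.
From mathcomp Require Import all_boot all_order all_algebra.
From mathcomp Require Import -(notations) mpoly.
From mathcomp Require Import all_classical all_reals all_analysis.
From mathcomp Require Import ring lra zify.

Set Implicit Arguments.
Unset Strict Implicit.
Unset Printing Implicit Defensive.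

Import Order.TTheory GRing.Theory Num.Theory.
Import numFieldNormedType.Exports.

Local Open Scope classical_set_scope.
Local Open Scope ring_scope.

(** For signs [al], [be], [ga] in {1, -1}, consider the rational function

      [F_N(s) = A(s) B(s) C(s) / (s + 1/2)^q],

    where [A(s)] is the sum over [0 <= j < N] of [al^j / (s - j)^m], [B(s)] is
    the same with [be] and [p], and [C(s)] is the sum over [-N <= k < N] of
    [ga^k / (s - k)].  It decays at least as fast as [1/s^2], so its residues
    add up to 0.  The poles are at [-1/2] and at the integers from [-N]
    to [N - 1].

    As [N] grows, the residue at [-1/2] tends to a polynomial in single values.
    At an integer [n >= 0] the regular parts of [A] and [B] are, up to zeta
    values, generated by the harmonic numbers of index [n], so the residue tends
    to [eps^n] times a combination of

      - [P_m(n) P_p(n) / (n + 1/2)^q], coming from the simple pole of [C] alone,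
      - terms with one harmonic number or none, over [(n + 1/2)^b], [b >= q],
        coming from those zeta values and from the polar parts of [A] and [B],

    where [eps = al be ga] and [P] stands for [H] or [- Hbar].  At [- (n + 1)]
    only [C] has a pole and the residue tends to [eps^(n+1) (-1)^(m+p+q)] times
    the same quadratic expression, plus terms with at most one harmonic number.
    When [eps = (-1)^(m+p+q)] the two quadratic expressions add up instead of
    cancelling, and the vanishing of the sum of the residues writes the
    quadratic sum through linear sums and single values.

    The residue theorem needed here is algebraic ([sum_residues]): it is proved
    by partial fractions on truncated Laurent expansions.  Letting [N] tend to
    infinity under the sum over [n] is Tannery's theorem ([tannery]), with
    majorant [(1 + H_n)^3 / (n + 1)^2].  If [m = 1] and [al = 1] the sum [A]
    diverges; adding the constant [H_N] to it makes everything converge and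
    amounts to replacing the missing [zeta(1)] by 0, and [R(1)] by [2 log 2]. *)

(** * The ring of reducible numbers *)

Section ReducibleNumbers.
Variable R : realType.
Implicit Types x y : R.

Let generator x := linear_Rsum x \/ single_value x.

Lemma mmap_rename (N M : nat) (s : 'I_N -> 'I_M) (v : 'I_M -> R)
    (P : mpoly N rat) :
  mmap (ratr : rat -> R) v
    (mmap (@mpolyC M rat) (fun i => mpolyX rat (mnm1 (s i))) P)
  = mmap (ratr : rat -> R) (v \o s) P.
Proof.
rewrite {2}/mmap raddf_sum /= [RHS]/mmap; apply: eq_bigr => k _.
rewrite rmorphM /= mmapC; congr (_ * _).
rewrite /mmap1 rmorph_prod /=; apply: eq_bigr => i _.
by rewrite rmorphXn /= mmapX mmap1U.
Qed.

(** Two polynomials are compared over the disjoint union of their variables. *)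
Lemma reducible_common x y : reducible x -> reducible y ->
  exists (N : nat) (v : 'I_N -> R) (P Q : mpoly N rat),
    [/\ forall i, generator (v i), x = mmap (ratr : rat -> R) v P
      & y = mmap (ratr : rat -> R) v Q].
Proof.
move=> [N [v [P [hv ->]]]] [M [w [Q [hw ->]]]].
pose u (i : 'I_(N + M)) : R :=
  match fintype.split i with inl j => v j | inr j => w j end.
exists (N + M)%N, u,
  (mmap (@mpolyC (N + M) rat) (fun i => mpolyX rat (mnm1 (lshift M i))) P),
  (mmap (@mpolyC (N + M) rat) (fun i => mpolyX rat (mnm1 (rshift N i))) Q).
split=> [i||].
- by rewrite /u; case: (fintype.split i).
- rewrite mmap_rename; congr mmap; apply: funext => i /=.
  by rewrite /u (unsplitK (inl i)).
- rewrite mmap_rename; congr mmap; apply: funext => i /=.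
  by rewrite /u (unsplitK (inr i)).
Qed.

(** As a boolean collective predicate, reducibility inherits the closure lemmas
    for subrings. *)
Definition reducibles : {pred R} := fun x => `[< reducible x >].

Lemma reduciblesP x : reflect (reducible x) (x \in reducibles).
Proof. exact: asboolP. Qed.

Lemma reducibles_generator x : generator x -> x \in reducibles.
Proof.
move=> gx; apply/reduciblesP; exists 1%N, (fun=> x), (mpolyX rat (mnm1 ord0)).
by split=> //; rewrite mmapX mmap1U.
Qed.

Lemma reducibles_ratr (c : rat) : ratr c \in reducibles.
Proof.
apply/reduciblesP; exists 0%N, (fun=> 0), (mpolyC 0 c).
by split=> [[]//|]; rewrite mmapC.
Qed.

Lemma reducibles_subring_closed : subring_closed reducibles.
Proof.
split=> [|x y /reduciblesP hx /reduciblesP hy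
        |x y /reduciblesP hx /reduciblesP hy].
- by rewrite -(rmorph1 (ratr : rat -> R)) reducibles_ratr.
- have [N [v [P [Q [hv -> ->]]]]] := reducible_common hx hy.
  by apply/reduciblesP; exists N, v, (P - Q); split=> //; rewrite rmorphB.
- have [N [v [P [Q [hv -> ->]]]]] := reducible_common hx hy.
  by apply/reduciblesP; exists N, v, (P * Q); split=> //; rewrite rmorphM.
Qed.

HB.instance Definition _ :=
  GRing.isSubringClosed.Build R reducibles reducibles_subring_closed.

End ReducibleNumbers.
Arguments reducibles : clear implicits.

(** * Truncated Laurent expansions and the sum of residues *)

Section Residues.
Variables (R : fieldType) (D : nat).
Implicit Types (w c : R) (s : seq R).

(** The power series of [t / (1 + t)], truncated at degree [D]. *)
Definition alt_geo (S : nzRingType) : {poly S} :=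
  'X * \sum_(r < D) (- 'X) ^+ r.

(** The expansion in [t] of [t / (s - c)] at [s = w + t], truncated at degree
    [D].  The factor [t] turns a Laurent series into a power series: the residue
    at [w] of a product of [d] factors [1 / (s - c)] is the coefficient of index
    [d - 1] in the product of the [laurent w c]. *)
Definition laurent w c : {poly R} :=
  if w == c then 1 else alt_geo R \Po ((w - c)^-1 *: 'X).

Lemma alt_geo_mul : (1 + 'X) * alt_geo R = 'X - 'X * (- 'X) ^+ D.
Proof.
rewrite /alt_geo mulrCA; transitivity ('X * (1 - (- 'X) ^+ D) : {poly R}).
  congr (_ * _).
  by rewrite -[RHS]opprB subrX1 -mulNr opprB opprK.
by rewrite mulrBr mulr1.
Qed.

Lemma laurent_mul w c :
  exists t, ((w - c)%:P + 'X) * laurent w c = 'X + 'X ^+ D.+1 * t.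
Proof.
rewrite /laurent; have [->|nwc] := eqVneq w c.
  by exists 0; rewrite subrr polyC0 add0r mulr0 addr0 mulr1.
have nz : w - c != 0 by rewrite subr_eq0.
set a := (w - c)^-1.
exists (- (- a)%:P ^+ D).
have -> : (w - c)%:P + 'X = (w - c)%:P * ((1 + 'X) \Po (a *: 'X)).
  rewrite comp_polyD comp_polyX -polyC1 comp_polyC mulrDr -polyCM mulr1.
  by rewrite -mul_polyC mulrA -polyCM divff // polyC1 mul1r.
have e1 : (w - c)%:P * (a *: 'X) = 'X.
  by rewrite -mul_polyC mulrA -polyCM divff // polyC1 mul1r.
have e2 : (- (a *: 'X)) ^+ D = (- a)%:P ^+ D * 'X ^+ D.
  by rewrite -mul_polyC -mulNr -polyCN exprMn.
rewrite -mulrA -comp_polyM alt_geo_mul comp_polyB comp_polyM rmorphXn /=.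
by rewrite rmorphN /= comp_polyX mulrBr mulrA e1 e2 exprS; ring.
Qed.

(** This is [1/((s-c)(s-c')) = (1/(s-c) - 1/(s-c'))/(c-c')], expanded at [w].
    Subtracting the equations [(t + w - c) L = t] for the two expansions gives
    it for all [w] alike, whether or not [w] is one of the poles. *)
Lemma laurent_partial_fraction w c c' :
  exists t, (c - c')%:P * (laurent w c * laurent w c')
    = 'X * (laurent w c - laurent w c') + 'X ^+ D.+1 * t.
Proof.
have [t ht] := laurent_mul w c; have [t' ht'] := laurent_mul w c'.
exists (laurent w c * t' - laurent w c' * t).
have -> : (c - c')%:P = ((w - c')%:P + 'X) - ((w - c)%:P + 'X).
  by rewrite !polyCB; ring.
rewrite mulrBl [X in X - _]mulrCA ht' [X in _ - X]mulrA ht.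
by ring.
Qed.

Lemma laurent_neq w c : w != c -> exists t, laurent w c = 'X * t.
Proof.
move=> nwc; rewrite /laurent (negbTE nwc) /alt_geo comp_polyM comp_polyX.
by rewrite -mul_polyC mulrAC mulrC; eexists.
Qed.

Variables (Om : seq R) (Om_uniq : uniq Om).

(** Induction on the number of factors.  If two of the poles differ, partial
    fractions give a difference of two products with one factor less, whose
    residue sums agree.  If all poles are equal to [c], the product is a power
    of [1 / (s - c)], with residue 0 unless the power is 1. *)
Lemma sum_residues_prod s : {subset s <= Om} -> (0 < size s <= D.+1)%N ->
  \sum_(w <- Om) (\prod_(c <- s) laurent w c)`_(size s).-1
  = (size s == 1%N)%:R.
Proof.
have [d] := ubnP (size s); elim: d s => // d IH [//|c s] /= lt_d sub le_D.
have cOm : c \in Om by apply: sub; rewrite mem_head.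
have [/allP all_c|] := boolP (all (pred1 c) s).
  have es : s = nseq (size s) c by apply/all_pred1P/allP.
  have prodE w :
      \prod_(x <- c :: s) laurent w x = laurent w c ^+ (size s).+1.
    rewrite es size_nseq -[c :: nseq _ _]/(nseq (size s).+1 c).
    by rewrite big_nseq iter_mulr_1.
  rewrite (bigD1_seq c) //= [X in _ + X]big1 => [|w nwc].
    by rewrite addr0 prodE /laurent eqxx expr1n coef1 eqSS.
  have [t laurent_t] := laurent_neq nwc.
  by rewrite prodE laurent_t exprMn coefXnM ltnSn.
move=> /allPn[c' c's /= nc].
have cc' : c - c' != 0 by rewrite subr_eq0 eq_sym.
have c'Om : c' \in Om by apply: sub; rewrite inE c's orbT.
have ps := perm_to_rem c's; set s' := rem c' s in ps.
have sz : size s = (size s').+1 by rewrite (perm_size ps).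
have sub' : {subset s' <= Om}.
  by move=> x /mem_rem xs; apply: sub; rewrite inE xs orbT.
have key w : (\prod_(x <- c :: s) laurent w x)`_(size s) =
    (c - c')^-1 * ((\prod_(x <- c :: s') laurent w x)`_(size s')
                   - (\prod_(x <- c' :: s') laurent w x)`_(size s')).
  apply: (mulfI cc'); rewrite mulrA divff // mul1r -coefCM.
  rewrite !big_cons (perm_big _ ps) /= big_cons.
  have [t ht] := laurent_partial_fraction w c c'.
  rewrite (mulrA (laurent w c) (laurent w c')) mulrA ht mulrDl coefD.
  rewrite -!mulrA coefXM sz /=.
  by rewrite coefXnM -sz le_D addr0 mulrBl coefB.
rewrite (eq_bigr _ (fun w _ => key w)) -big_distrr /= sumrB.
have hs z : z \in Om -> {subset z :: s' <= Om}.
  by move=> zOm x; rewrite inE => /orP[/eqP->//|/sub'].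
have bnd : (0 < (size s').+1 <= D.+1)%N.
  by move: le_D; rewrite sz => /ltnW.
have ltd : ((size s').+1 < d)%N by rewrite -sz.
have := IH (c :: s') ltd (hs _ cOm) bnd; rewrite /= => ->.
have := IH (c' :: s') ltd (hs _ c'Om) bnd; rewrite /= => ->.
by rewrite subrr mulr0 sz.
Qed.

(** [pf_span d k F] says that [F w] is [t^d] times the expansion at [w] of a
    combination of products of at least [k] factors [1 / (s - c)].  A product
    with fewer than [d] factors is padded by a power of ['X], which allows for
    constant terms in the kernels; [k] measures the decay at infinity. *)
Inductive pf_span : nat -> nat -> (R -> {poly R}) -> Prop :=
| PfProd s i F of {subset s <= Om}
    & (forall w, F w = 'X ^+ i * \prod_(c <- s) laurent w c) :
    pf_span (size s + i) (size s) F
| PfWeaken d k l F of pf_span d k F & (l <= k)%N : pf_span d l F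
| Pf0 d k : pf_span d k (fun=> 0)
| PfDZ d k a F G of pf_span d k F & pf_span d k G :
    pf_span d k (fun w => a *: F w + G w).

Lemma pf_span_ext d k F G : pf_span d k F -> F =1 G -> pf_span d k G.
Proof. by move=> + FG; have -> : G = F by apply: funext => w; rewrite FG. Qed.

Lemma pf_spanM d k F e l G : pf_span d k F -> pf_span e l G ->
  pf_span (d + e) (k + l) (fun w => F w * G w).
Proof.
move=> hF; elim: hF e l G => {d k F}.
- move=> s i F sub FE e l G hG; elim: hG => {e l G}.
  + move=> s' j G sub' GE; rewrite addnACA -size_cat.
    apply: PfProd => [x|w].
      by rewrite mem_cat => /orP[/sub|/sub'].
    by rewrite FE GE big_cat exprD /=; ring.
  + by move=> e k l G _ IH lk; apply: PfWeaken IH _; rewrite leq_add2l.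
  + by move=> e k; apply: (pf_span_ext (Pf0 _ _)) => w; rewrite mulr0.
  + move=> e k a G G' _ IH _ IH'; apply: (pf_span_ext (PfDZ a IH IH')) => w.
    by rewrite mulrDr scalerAr.
- move=> d k l F _ IH lk e l' G hG; apply: PfWeaken (IH _ _ _ hG) _.
  by rewrite leq_add2r.
- by move=> d k e l G _; apply: (pf_span_ext (Pf0 _ _)) => w; rewrite mul0r.
- move=> d k a F F' _ IH _ IH' e l G hG.
  apply: (pf_span_ext (PfDZ a (IH _ _ _ hG) (IH' _ _ _ hG))) => w.
  by rewrite mulrDl scalerAl.
Qed.

Lemma pf_span_laurentX n c : c \in Om ->
  pf_span n n (fun w => laurent w c ^+ n).
Proof.
move=> cOm.
have -> : pf_span n n = pf_span (size (nseq n c) + 0) (size (nseq n c)).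
  by rewrite size_nseq addn0.
apply: PfProd => [x|w]; first by rewrite mem_nseq => /andP[_ /eqP->].
by rewrite big_nseq iter_mulr_1 mul1r.
Qed.

Lemma pf_span_sum (I : eqType) (r : seq I) d k (a : I -> R)
    (F : I -> R -> {poly R}) :
  (forall i, i \in r -> pf_span d k (F i)) ->
  pf_span d k (fun w => \sum_(i <- r) a i *: F i w).
Proof.
elim: r => [|i r IH] hF.
  by apply: (pf_span_ext (Pf0 _ _)) => w; rewrite big_nil.
have h j : j \in r -> pf_span d k (F j).
  by move=> jr; apply: hF; rewrite inE jr orbT.
apply: (pf_span_ext (PfDZ (a i) (hF i (mem_head _ _)) (IH h))) => w.
by rewrite big_cons.
Qed.

(** Two factors [1 / (s - c)] in every term is the decay of order 2 at infinity
    that the residue theorem asks for. *)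
Lemma sum_residues d k F : pf_span d k F -> (2 <= k)%N -> (d <= D.+1)%N ->
  \sum_(w <- Om) (F w)`_d.-1 = 0.
Proof.
elim=> {d k F}.
- move=> s i F sub FE; case: s sub FE => [//|x [//|y s]] sub FE _ le_D.
  rewrite (eq_bigr (fun w => (\prod_(c <- [:: x, y & s]) laurent w c)`_
    (size [:: x, y & s]).-1)).
    rewrite sum_residues_prod //=.
    by rewrite (leq_trans _ le_D) // leq_addr.
  by move=> w _; rewrite FE coefXnM addSn ltnNge leq_addl /= addnK.
- by move=> d k l F _ IH lk l2 dD; apply: IH => //; apply: leq_trans lk.
- by move=> d k _ _; rewrite big1 // => w _; rewrite coef0.
- move=> d k a F G _ IH _ IH' k2 dD.
  rewrite (eq_bigr (fun w => a * (F w)`_d.-1 + (G w)`_d.-1)).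
    by rewrite big_split /= -big_distrr /= IH // IH' // mulr0 addr0.
  by move=> w _; rewrite coefD coefZ.
Qed.

(** The coefficient of index [r] of [(t / (1 + t))^m].  The expansions of
    [1 / (s - c)^m] at all points [w <> c] come from this one by scaling [t], so
    that their coefficients are [kappa m r] times powers of [w - c]. *)
Definition kappa (m r : nat) : int := (alt_geo int ^+ m)`_r.

Lemma alt_geo_intr : alt_geo R = map_poly intr (alt_geo int).
Proof.
rewrite /alt_geo rmorphM /= map_polyX raddf_sum /=; congr (_ * _).
by apply: eq_bigr => i _; rewrite rmorphXn rmorphN /= map_polyX.
Qed.

Lemma coef_comp_scaleX (p : {poly R}) a r :
  (p \Po (a *: 'X))`_r = p`_r * a ^+ r.
Proof.
rewrite -[in LHS](coefK p) poly_def raddf_sum /= coef_sum.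
have E (i : 'I_(size p)) : (p`_i *: 'X^i \Po a *: 'X)`_r
   = if i == r :> nat then p`_r * a ^+ r else 0.
  rewrite comp_polyZ comp_Xn_poly exprZn !coefZ coefXn eq_sym.
  by case: eqP => [->|]; rewrite ?mulr1 ?mulr0.
rewrite (eq_bigr _ (fun i _ => E i)).
have [ltr|ler] := ltnP r (size p).
  by rewrite -big_mkcond /= (big_pred1 (Ordinal ltr)).
rewrite nth_default // mul0r big1 // => i _.
by case: eqP => // e; move: (ltn_ord i); rewrite e ltnNge ler.
Qed.

Lemma coef_laurentX m w c r : (laurent w c ^+ m)`_r =
  if w == c then (r == 0%N)%:R else (kappa m r)%:~R * (w - c)^-1 ^+ r.
Proof.
rewrite /laurent; case: eqP => _; first by rewrite expr1n coef1.
by rewrite -rmorphXn /= coef_comp_scaleX alt_geo_intr -rmorphXn /= coef_map.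
Qed.

End Residues.

Lemma kappa_lt D m r : (r < m)%N -> kappa D m r = 0.
Proof. by move=> rm; rewrite /kappa /alt_geo exprMn coefXnM rm. Qed.

Lemma kappa_diag D m : (0 < D)%N -> kappa D m m = 1.
Proof.
case: D => // D _; rewrite /kappa /alt_geo exprMn coefXnM ltnn subnn.
rewrite -horner_coef0 horner_exp big_ord_recl expr0 hornerD hornerC.
rewrite horner_sum big1 ?addr0 ?expr1n // => i _.
by rewrite horner_exp hornerN hornerX oppr0 expr0n.
Qed.

(** * Exchange of limits, alternating series, a majorant *)

Section SeriesTools.
Variable R : realType.
Implicit Types (u g t c : nat -> R).

Lemma cvg_sum_seq (I : Type) (r : seq I) (F : I -> nat -> R) (l : I -> R) :
  (forall i, F i n @[n --> \oo] --> l i) ->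
  (\sum_(i <- r) F i n) @[n --> \oo] --> \sum_(i <- r) l i.
Proof.
move=> Fl; elim: r => [|i r IH].
  rewrite big_nil; under eq_fun do rewrite big_nil.
  exact: cvg_cst.
rewrite big_cons; under eq_fun do rewrite big_cons.
exact: cvgD.
Qed.

Lemma cvg_dominated u g : (forall n, `|u n| <= g n) -> cvgn (series g) ->
  cvgn (series u).
Proof.
move=> ug cg; apply: normed_cvg; apply: series_le_cvg cg => n //=.
exact: le_trans (normr_ge0 _) (ug n).
Qed.

(** Beyond an index [M] both [T N n] and [t n] are bounded by the tail of [g];
    below it there are finitely many [n], where [T N] converges termwise. *)
Lemma tannery (T : nat -> nat -> R) t g :
  (forall N n, (n < N)%N -> `|T N n| <= g n) ->
  (forall n, T N n @[N --> \oo] --> t n) -> cvgn (series g) ->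
  cvgn (series t) /\
  (\sum_(0 <= n < N) T N n) @[N --> \oo] --> limn (series t).
Proof.
move=> Tg Tt cg.
have tg n : `|t n| <= g n.
  apply: (cvgr_to_le (cvg_norm (Tt n))).
  by near=> N; apply: Tg; near: N; exists n.+1.
have ct : cvgn (series t) by apply: cvg_dominated cg.
have g0 n : 0 <= g n by exact: le_trans (normr_ge0 _) (tg n).
split=> //; apply: (cvg_sub0 _ ct).
have eqd : (fun N => \sum_(0 <= n < N) T N n) - series t
    = (fun N => \sum_(0 <= n < N) (T N n - t n)).
  by apply: funext => N; rewrite sumrB.
rewrite eqd; apply/cvgr0Pnorm_lt => e e0.
have e3 : 0 < e / 3 by rewrite divr_gt0.
have [M _ hM] := (cvgrPdist_lt _ _).1 cg _ e3.
have fin : (\sum_(0 <= n < M) `|T N n - t n|) @[N --> \oo] --> (0 : R).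
  rewrite -[X in _ --> X](@big1_eq R 0 +%R _ (index_iota 0 M) xpredT).
  apply: cvg_sum_seq => n; rewrite -[X in _ --> X](@normr0 _ R).
  apply: cvg_norm; rewrite -(subrr (t n)).
  by apply: cvgB; [exact: Tt|exact: cvg_cst].
near=> N.
have MN : (M <= N)%N by near: N; exists M.
rewrite (le_lt_trans (ler_norm_sum _ _ _)) // (big_cat_nat (n := M)) //=.
have h1 : \sum_(0 <= n < M) `|T N n - t n| < e / 3.
  rewrite -[X in X < _]ger0_norm ?sumr_ge0 //.
  by near: N; apply: (cvgr0Pnorm_lt _).1 => //; exact: fin.
have h2 : \sum_(M <= n < N) `|T N n - t n| <= (series g N - series g M) *+ 2.
  rewrite sub_series MN -sumrMnl big_nat_cond [leRHS]big_nat_cond.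
  apply: ler_sum => n /andP[/andP[_ nN] _].
  by rewrite (le_trans (ler_normB _ _)) // mulr2n lerD // Tg.
have h3 : series g N - series g M < (e / 3) *+ 2.
  have := hM N MN; have := hM M (leqnn M); rewrite /= !ltr_norml.
  by rewrite mulr2n => /andP[a1 a2] /andP[a3 a4]; lra.
have h4 : series g N - series g M <= limn (series g) - series g M.
  rewrite lerD2r; apply: nondecreasing_cvgn_le => //.
  exact: nondecreasing_series.
have h5 : limn (series g) - series g M < e / 3.
  by have := hM M (leqnn M); rewrite /= ltr_norml => /andP[].
by lra.
Unshelve. all: by end_near. Qed.

(** Summation by parts: twice the partial sum is, up to boundary terms, the
    partial sum of [(-1)^k (c k - c k.+1)], and the differences have a
    telescoping sum. *)
Lemma cvg_alternating c : nonincreasing_seq c -> c n @[n --> \oo] --> (0 : R) ->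
  cvgn (series (fun k => (-1) ^+ k * c k)).
Proof.
move=> c_noninc c0.
pose d k := c k - c k.+1.
have cd : cvgn (series d).
  apply/cvg_ex; exists (c 0%N - 0).
  have -> : series d = (fun n => c 0%N - c n).
    apply: funext => n; rewrite /series /= -[RHS]opprB -telescope_sumr //.
    by rewrite -sumrN; apply: eq_bigr => k _; rewrite opprB.
  by apply: cvgB => //; exact: cvg_cst.
have cad : cvgn (series (fun k => (-1) ^+ k * d k)).
  apply: cvg_dominated cd => n; rewrite normrM normrX normrN1 expr1n mul1r.
  by rewrite ger0_norm // subr_ge0 c_noninc.
have E n : series (fun k => (-1) ^+ k * c k) n =
  2^-1 * (c 0%N + series (fun k => (-1) ^+ k * d k) n - (-1) ^+ n * c n).
  elim: n => [|n IH]; first by rewrite /series /= !big_geq // expr0; lra.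
  by rewrite !seriesSr IH /d exprS; lra.
rewrite (funext E); apply/cvg_ex; eexists.
apply: cvgMl_tmp; apply: cvgB; last first.
  apply: norm_cvg0; under eq_fun do
    rewrite normrM normrX normrN1 expr1n mul1r.
  by rewrite -(normr0 R); apply: cvg_norm.
by apply: cvgD cad; exact: cvg_cst.
Qed.

(** The bound [1 + H_n] for all harmonic numbers of index [n]; the summand 1
    makes it a bound for constants as well. *)
Definition harmonic_growth n : R := 1 + \sum_(0 <= k < n) k.+1%:R^-1.

Lemma harmonic_growthS n :
  harmonic_growth n.+1 = harmonic_growth n + n.+1%:R^-1.
Proof. by rewrite /harmonic_growth big_nat_recr //= addrA. Qed.

Lemma harmonic_growth_ge1 n : 1 <= harmonic_growth n.
Proof. by rewrite lerDl sumr_ge0. Qed.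

(** With [p(x) = x^3 + 3 x^2 + 6 x + 6] one has [p - p' = x^3], so that
    [- x^3 / n^2] is the derivative of [p(x) / n] for [x = log n].  The discrete
    analogue is an inequality that bounds the series by a telescoping sum. *)
Lemma cvg_harmonic_growth3 :
  cvgn (series (fun n => harmonic_growth n ^+ 3 * n.+1%:R^-1 ^+ 2)).
Proof.
pose p (x : R) := x ^+ 3 + 3 * x ^+ 2 + 6 * x + 6.
pose v n := p (harmonic_growth n) * n%:R^-1.
apply: nondecreasing_is_cvgn.
  apply: nondecreasing_series => n _ _; rewrite mulr_ge0 ?exprn_ge0 //.
  by rewrite (le_trans ler01) ?harmonic_growth_ge1.
have step n : harmonic_growth n.+1 ^+ 3 * n.+2%:R^-1 ^+ 2 <= v n.+1 - v n.+2.
  rewrite /v (harmonic_growthS n.+1); set x := harmonic_growth n.+1.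
  have x1 : 1 <= x by exact: harmonic_growth_ge1.
  set d : R := n.+2%:R^-1.
  have d0 : 0 < d by rewrite invr_gt0.
  have dE : n.+1%:R^-1 = d / (1 - d).
    have -> : 1 - d = n.+1%:R * d.
      have : n.+2%:R * d = 1 by rewrite /d mulfV // pnatr_eq0.
      by rewrite -[n.+2%:R]natr1 => dn; lra.
    by rewrite invfM mulrCA divff ?mulr1 // gt_eqF.
  have d1 : d < 1 by rewrite invf_lt1 // ltr1n.
  rewrite dE.
  have d1' : 0 < 1 - d by lra.
  set s := d / (1 - d); have sE : s * (1 - d) = d by rewrite divfK // gt_eqF.
  have s0 : 0 < s by rewrite divr_gt0.
  have -> : p x * s - p (x + d) * d = s * (p x - (1 - d) * p (x + d)).
    by rewrite -{2}sE; ring.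
  have ds : d <= s by rewrite ler_pdivlMr // ler_piMr //; lra.
  have h : d * x ^+ 3 <= p x - (1 - d) * p (x + d).
    have -> : p x - (1 - d) * p (x + d) = d * x ^+ 3 + d ^+ 2 *
        (3 * x ^+ 2 + 3 * x + 3 + d * (3 * x + 2) + d ^+ 2) by rewrite /p; ring.
    rewrite lerDl; apply: mulr_ge0; first by rewrite exprn_ge0 // ltW.
    have := mulr_ge0 (ltW d0) (le_trans ler01 x1).
    have := exprn_ge0 2 (le_trans ler01 x1).
    by have := exprn_ge0 2 (ltW d0); lra.
  apply: le_trans (ler_wpM2l (ltW s0) h).
  have -> : x ^+ 3 * d ^+ 2 = d * (d * x ^+ 3) by ring.
  by rewrite ler_wpM2r // mulr_ge0 ?exprn_ge0 ?(le_trans ler01 x1) // ltW.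
exists (harmonic_growth 0 ^+ 3 + v 1%N) => _ [n _ <-].
have v0 k : 0 <= v k.
  have := harmonic_growth_ge1 k; rewrite /v /p => L1.
  by rewrite mulr_ge0 ?invr_ge0 // !addr_ge0 ?mulr_ge0 ?exprn_ge0 //; lra.
have h0 : 0 <= harmonic_growth 0 ^+ 3.
  by rewrite exprn_ge0 // (le_trans ler01) ?harmonic_growth_ge1.
case: n => [|n]; first by rewrite /series /= big_geq // addr_ge0.
suff : series (fun n => harmonic_growth n ^+ 3 * n.+1%:R^-1 ^+ 2) n.+1
    <= harmonic_growth 0 ^+ 3 + v 1%N - v n.+1.
  by move/le_trans; apply; rewrite gerBl.
elim: n => [|n IH]; first by rewrite seriesSr /series /= big_geq // invr1; lra.
by rewrite seriesSr (le_trans (lerD IH (step n))) // addrA subrK.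
Qed.
End SeriesTools.

(** * Harmonic numbers and single values *)

Section SingleValues.
Variable R : realType.
Implicit Types (a : bool) (r n N : nat).

(** The sign [1] or [(-1)^n], according to [a]: the flag [true] marks the
    alternating sums. *)
Definition sgn a n : R := ((-1) ^+ a) ^+ n.

Lemma sgnS a n : sgn a n.+1 = (-1) ^+ a * sgn a n.
Proof. exact: exprS. Qed.

Lemma sgnD a m n : sgn a (m + n) = sgn a m * sgn a n.
Proof. exact: exprD. Qed.

Lemma sgnMM a n : sgn a n * sgn a n = 1.
Proof. by rewrite /sgn -exprMn -expr2 sqrr_sign expr1n. Qed.

Lemma norm_sgn a n : `|sgn a n| = 1.
Proof. by rewrite /sgn normrX normr_sign expr1n. Qed.

Lemma sgn_false n : sgn false n = 1.
Proof. by rewrite /sgn expr1n. Qed.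

Lemma sgn_true n : sgn true n = (-1) ^+ n.
Proof. by []. Qed.

(** This is [H] for the flag [false] and [- Hbar] for [true]. *)
Definition psum a r n : R := \sum_(0 <= k < n) sgn a k.+1 * k.+1%:R^-1 ^+ r.

(** The analogue of [psum] over [k + 1/2], [0 <= k < n], whose limits are the
    values [R]. *)
Definition hsum a r n : R := \sum_(0 <= k < n) sgn a k * (k%:R + 2^-1)^-1 ^+ r.

Lemma H_psum r n : H R r n = psum false r n.
Proof.
rewrite /H big_add1 /psum; apply: eq_bigr => k _.
by rewrite sgn_false mul1r exprVn.
Qed.

Lemma Hbar_psum r n : Hbar R r n = - psum true r n.
Proof.
rewrite /Hbar big_add1 /psum -sumrN; apply: eq_bigr => k _ /=.
by rewrite sgn_true exprS exprVn mulN1r mulNr opprK.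
Qed.

Lemma cvg_bound (u : nat -> R) (l : R) : u n @[n --> \oo] --> l ->
  exists2 K, 0 <= K & forall n, `|u n| <= K.
Proof.
move=> ul; have /cvg_has_ub[K hK] : cvgn u by apply/cvg_ex; exists l.
have h n : `|u n| <= K by apply: hK; exists n.
by exists K => //; apply: le_trans (h 0%N).
Qed.

(** Leibniz's criterion in the alternating case, comparison with [1 / (k + 1)^2]
    otherwise. *)
Lemma cvg_sgn_power a r (c : nat -> R) : (0 < r)%N -> a || (1 < r)%N ->
    (forall k, 0 <= c k <= 2 * k.+1%:R^-1) -> nonincreasing_seq c ->
  cvgn (series (fun k => sgn a k * c k ^+ r)).
Proof.
move=> r0 ar cb c_noninc.
have c0 k : 0 <= c k by case/andP: (cb k).
case: a ar => [_|/= r1].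
  apply: cvg_alternating => [m n mn|].
    by rewrite lerXn2r ?nnegrE // c_noninc.
  have cl : c n @[n --> \oo] --> (0 : R).
    apply: (squeeze_cvgr (nearW _ _) (cvg_cst 0)) => [k|]; first exact: cb.
    rewrite -(mulr0 2); apply: cvgMl_tmp; exact: cvg_harmonic.
  case: r r0 => // r _; elim: r => [|r IH]; first exact: cl.
  by under eq_fun do rewrite exprS; rewrite -(mulr0 0); apply: cvgM.
apply: (cvg_dominated (g := 2 ^+ r *:
    (fun n => harmonic_growth R n ^+ 3 * n.+1%:R^-1 ^+ 2))).
  move=> k; rewrite sgn_false mul1r ger0_norm ?exprn_ge0 //.
  case/andP: (cb k) => _ cbk.
  have le1 : c k ^+ r <= (2 * k.+1%:R^-1) ^+ r.
    by rewrite lerXn2r ?nnegrE // mulr_ge0.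
  apply: le_trans le1 _; rewrite exprMn; apply: ler_wpM2l => //.
  have inv1 : (k.+1%:R^-1 : R) <= 1 by rewrite invf_le1 // ler1n.
  apply: (@le_trans _ _ (k.+1%:R^-1 ^+ 2)).
    by rewrite ler_wiXn2l.
  rewrite ler_peMl ?exprn_ge0 //.
  by rewrite exprn_ege1 // harmonic_growth_ge1.
apply: is_cvg_seriesZ; exact: cvg_harmonic_growth3.
Qed.

Lemma cvg_psum a r : (0 < r)%N -> a || (1 < r)%N -> cvgn (psum a r).
Proof.
move=> r0 ar.
have -> : psum a r = (fun n => (-1) ^+ a *
    series (fun k => sgn a k * k.+1%:R^-1 ^+ r) n).
  apply: funext => n; rewrite /psum /series /= big_distrr /=.
  by apply: eq_bigr => k _; rewrite mulrA -sgnS.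
apply/cvg_ex; eexists; apply: cvgMl_tmp.
apply: cvg_sgn_power => // [k|m n mn].
  by rewrite invr_ge0 ler0n /= ler_peMl // ler1n.
by rewrite lef_pV2 ?posrE // ler_nat.
Qed.

Lemma half_gt0 n : 0 < n%:R + 2^-1 :> R.
Proof. by rewrite ltr_wpDl // invr_gt0. Qed.

Lemma inv_half_le n : (n%:R + 2^-1 : R)^-1 <= 2 * n.+1%:R^-1.
Proof.
have -> : 2 * n.+1%:R^-1 = (2^-1 * n.+1%:R)^-1 :> R by rewrite invfM invrK.
rewrite lef_pV2 ?posrE ?half_gt0 ?mulr_gt0 ?invr_gt0 //.
by rewrite -[n.+1%:R]natr1; have := ler0n R n; lra.
Qed.

Lemma cvg_hsum a r : (0 < r)%N -> a || (1 < r)%N -> cvgn (hsum a r).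
Proof.
move=> r0 ar; apply: cvg_sgn_power => // [k|m n mn].
  by rewrite invr_ge0 ltW ?half_gt0 //= inv_half_le.
by rewrite lef_pV2 ?posrE ?half_gt0 // lerD2r ler_nat.
Qed.

Lemma lim_psum a r : (0 < r)%N -> a || (1 < r)%N ->
  psum a r n @[n --> \oo] --> (if a then zetabar R r else zeta R r).
Proof.
move=> r0 ar; have cP := cvg_psum r0 ar.
suff -> : (if a then zetabar R r else zeta R r) = limn (psum a r) by [].
have E n : psum a r n = \sum_(1 <= k < n.+1)
    (if a then (-1) ^+ k / (k%:R : R) ^+ r else ((k%:R : R) ^+ r)^-1).
  rewrite big_add1; apply: eq_bigr => k _; case: (a).
    by rewrite sgn_true exprVn.
  by rewrite sgn_false mul1r exprVn.
case: a ar cP E => ar cP E; apply: cvg_lim => //;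
  rewrite -cvg_shiftS /=; apply: cvg_trans cP;
  by under [X in X @ _ --> _]funext => n do rewrite -E.
Qed.

Lemma lim_hsum a r : (0 < r)%N -> a || (1 < r)%N ->
  hsum a r n @[n --> \oo] --> (if a then - Rbar R r else Rval R r).
Proof.
move=> r0 ar; have cP := cvg_hsum r0 ar.
suff -> : (if a then - Rbar R r else Rval R r) = limn (hsum a r) by [].
have eh k : k.+1%:R - 2^-1 = k%:R + 2^-1 :> R by rewrite -[k.+1%:R]natr1; lra.
case: a ar cP => ar cP.
  have E n : \sum_(1 <= k < n.+1) ((-1) ^+ k / (k%:R - 2^-1 : R) ^+ r)
      = - hsum true r n.
    rewrite big_add1 /hsum -sumrN; apply: eq_bigr => k _.
    by rewrite eh exprS mulN1r mulNr -exprVn sgn_true.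
  apply: oppr_inj; rewrite opprK -limN //; apply: cvg_lim => //.
  rewrite -cvg_shiftS /=; apply: cvg_trans (is_cvgN cP).
  by under [X in X @ _ --> _]funext => n do rewrite E.
have E n : \sum_(1 <= k < n.+1) ((k%:R - 2^-1 : R) ^+ r)^-1 = hsum false r n.
  rewrite big_add1 /hsum; apply: eq_bigr => k _.
  by rewrite eh -exprVn sgn_false mul1r.
rewrite /Rval gtn_eqF //.
apply: cvg_lim => //; rewrite -cvg_shiftS /=; apply: cvg_trans cP.
by under [X in X @ _ --> _]funext => n do rewrite E.
Qed.

End SingleValues.

(** * Regularization of the divergent sums *)

Section Regularization.
Variable R : realType.
Implicit Types (a : bool) (r n N : nat).

Local Notation psum := (psum R).
Local Notation hsum := (hsum R).
Local Notation sgn := (sgn R).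
Local Notation L := (harmonic_growth R).

Lemma psum1E n : psum false 1 n = \sum_(0 <= k < n) k.+1%:R^-1.
Proof. by apply: eq_bigr => k _; rewrite sgn_false mul1r. Qed.

Lemma psum1S n : psum false 1 n.+1 = psum false 1 n + n.+1%:R^-1.
Proof. by rewrite !psum1E big_nat_recr. Qed.

Lemma growth_psum n : L n = 1 + psum false 1 n.
Proof. by rewrite psum1E. Qed.

(** The sequence decreases and is nonnegative; its limit is Euler's constant. *)
Lemma cvg_psum1_sub_ln : cvgn (fun n => psum false 1 n.+1 - ln (n.+1%:R : R)).
Proof.
apply: nonincreasing_is_cvgn.
  apply/nonincreasing_seqP => n.
  rewrite psum1S -addrA lerD2l lerBlDr.
  have n2 : 0 < n.+2%:R :> R by [].
  have n1 : 0 < n.+1%:R :> R by [].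
  have lt1 : -1 < - n.+2%:R^-1 :> R by rewrite ltrN2 invf_lt1 // ltr1n.
  have := le_ln1Dx lt1.
  have -> : 1 - n.+2%:R^-1 = n.+1%:R / n.+2%:R :> R.
    rewrite -[X in X / _](addrK 1) natr1 mulrBl mul1r divff //.
  by rewrite ln_div ?posrE // => h; rewrite -lerN2 opprD opprK.
exists 0 => _ [n _ <-]; rewrite subr_ge0.
have : ln (n.+1%:R : R) <= psum false 1 n.
  elim: n => [|n IH]; first by rewrite ln1 /psum big_geq.
  rewrite psum1S.
  have n1 : 0 < n.+1%:R :> R by [].
  have e : n.+2%:R = n.+1%:R * (1 + n.+1%:R^-1) :> R.
    by rewrite mulrDr mulr1 divff ?natr1 // gt_eqF.
  have i1 : 0 < n.+1%:R^-1 :> R by rewrite invr_gt0.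
  rewrite e lnM ?posrE ?addr_gt0 // lerD //.
  by apply: le_ln1Dx; apply: lt_trans i1; rewrite ltrN10.
by move/le_trans; apply; rewrite psum1S lerDl invr_ge0.
Qed.

Lemma hsum1_double n :
  hsum false 1 n = 2 * psum false 1 n.*2 - psum false 1 n.
Proof.
elim: n => [|n IH]; first by rewrite /hsum /psum !big_geq //; lra.
rewrite doubleS !psum1S /hsum big_nat_recr //= -/(hsum false 1 n) IH.
rewrite sgn_false mul1r expr1.
have h : n.*2.+1%:R = 2 * (n%:R + 2^-1) :> R.
  by rewrite -natr1 -mul2n natrM; lra.
have h' : n.*2.+2%:R = 2 * n.+1%:R :> R by rewrite -doubleS -mul2n natrM.
rewrite h h' !invfM.
set x := (n%:R + 2^-1)^-1; set y := n.+1%:R^-1; lra.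
Qed.

(** By [hsum1_double] the difference is [2 (H_{2n} - H_n)]; comparing harmonic
    numbers with logarithms, Euler's constant cancels and [2 log 2] remains. *)
Lemma cvg_hsum_sub_psum :
  hsum false 1 n - psum false 1 n @[n --> \oo] --> Rval R 1.
Proof.
rewrite -cvg_shiftS /= /Rval eqxx.
set x := fun n => psum false 1 n.+1 - ln (n.+1%:R : R).
have E n : hsum false 1 n.+1 - psum false 1 n.+1
    = 2 * (x n.*2.+1 - x n + ln 2).
  rewrite hsum1_double /x doubleS.
  have -> : n.*2.+2%:R = 2 * n.+1%:R :> R by rewrite -doubleS -mul2n natrM.
  rewrite lnM ?posrE //; lra.
rewrite (funext E); apply: cvgMl_tmp.
have cx := cvg_psum1_sub_ln.
rewrite -[X in _ --> X]add0r -(subrr (limn x)).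
apply: cvgD; last exact: cvg_cst.
apply: cvgB => //.
have d : n.*2.+1 @[n --> \oo] --> \oo.
  apply/cvgnyPge => M; near=> n; apply: leqW.
  by rewrite -addnn (leq_trans _ (leq_addr _ _)) //; near: n; exists M.
apply: cvg_comp; [exact: d|exact: cx].
Unshelve. all: by end_near. Qed.

(** The constant to be added to the sum of [(+-1)^j / (s - j)^r] over
    [0 <= j < N] to make it converge: [H_N] for [r = 1] without signs. *)
Definition reg a r N := if ~~ a && (r == 1%N) then psum false 1 N else 0.

(** The limit of the regularized sum of [(+-1)^j / (- j)^r] over [j >= 1]; the
    regularization turns [zeta(1)] into 0. *)
Definition zeta_lim a r : R :=
  if ~~ a && (r == 1%N) then 0
  else (-1) ^+ r * (if a then zetabar R r else zeta R r).

(** The limit of the regularized sum of [(+-1)^j / (- 1/2 - j)^r] over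
    [j >= 0]; here the regularization produces [- 2 log 2]. *)
Definition half_lim a r : R :=
  (-1) ^+ r * (if a then - Rbar R r else Rval R r).

Lemma zeta_lim_red a r : (0 < r)%N -> zeta_lim a r \in reducibles R.
Proof.
move=> r0; rewrite /zeta_lim; case: ifPn => [_|]; first exact: rpred0.
move=> ar; rewrite rpredM ?rpredX ?rpredN1 //.
apply: reducibles_generator; right; case: a ar => /= [_|r1].
  exact: Single_zetabar.
by apply: Single_zeta; rewrite ltn_neqAle eq_sym r1.
Qed.

Lemma half_lim_red a r : (0 < r)%N -> half_lim a r \in reducibles R.
Proof.
move=> r0; rewrite rpredM ?rpredX ?rpredN1 //.
case: a; rewrite ?rpredN; apply: reducibles_generator; right.
  exact: Single_Rbar.
exact: Single_R.
Qed.

Lemma cvg_psum_reg a r : (0 < r)%N ->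
  (-1) ^+ r * psum a r n + reg a r n @[n --> \oo] --> zeta_lim a r.
Proof.
move=> r0; rewrite /reg /zeta_lim.
have [/andP[na /eqP->]|] := boolP (~~ a && (r == 1%N)).
  rewrite (negbTE na); under eq_fun do rewrite expr1 mulN1r addNr.
  exact: cvg_cst.
move=> ar; under eq_fun do rewrite addr0.
apply: cvgMl_tmp; apply: lim_psum => //.
by move: ar; rewrite negb_and negbK ltn_neqAle eq_sym r0 andbT.
Qed.

Lemma cvg_hsum_reg a r : (0 < r)%N ->
  (-1) ^+ r * hsum a r n + reg a r n @[n --> \oo] --> half_lim a r.
Proof.
move=> r0; rewrite /reg /half_lim.
have [/andP[na /eqP->]|] := boolP (~~ a && (r == 1%N)).
  rewrite (negbTE na) expr1 mulN1r.
  under eq_fun do rewrite mulN1r addrC -opprB.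
  apply: cvgN; exact: cvg_hsum_sub_psum.
move=> ar; under eq_fun do rewrite addr0.
apply: cvgMl_tmp; apply: lim_hsum => //.
by move: ar; rewrite negb_and negbK ltn_neqAle eq_sym r0 andbT.
Qed.

Lemma psum1_addn_sub m n :
  psum false 1 (m + n) - psum false 1 m = \sum_(0 <= k < n) (m + k).+1%:R^-1.
Proof.
rewrite !psum1E (big_cat_nat (n := m)) ?leq_addr //= addrAC subrr add0r.
by rewrite -{1}[m]add0n big_addn addKn; apply: eq_bigr => k _; rewrite addnC.
Qed.

Lemma psum1_addn_sub_bound m n :
  0 <= psum false 1 (m + n) - psum false 1 m <= psum false 1 n.
Proof.
rewrite psum1_addn_sub sumr_ge0 // psum1E /=; apply: ler_sum => k _.
by rewrite lef_pV2 ?posrE // ler_nat ltnS leq_addl.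
Qed.

Lemma cvg_psum1_addn_sub n :
  psum false 1 (m + n) - psum false 1 m @[m --> \oo] --> (0 : R).
Proof.
have h k : (m + k).+1%:R^-1 @[m --> \oo] --> (0 : R).
  by have := @cvg_harmonic R; rewrite -(cvg_shiftn k).
have := cvg_sum_seq (r := index_iota 0 n) h; rewrite big1_eq; apply: cvg_trans.
by under [X in X @ _ --> _]eq_fun do rewrite psum1_addn_sub.
Qed.

Lemma reg_addn_sub_bound a r m n :
  `|reg a r (m + n) - reg a r m| <= psum false 1 n.
Proof.
have /andP[h1 h2] := psum1_addn_sub_bound m n.
rewrite /reg; case: ifP => _; first by rewrite ger0_norm.
by rewrite subrr normr0 (le_trans h1 h2).
Qed.

Lemma cvg_reg_addn_sub a r n :
  reg a r (m + n) - reg a r m @[m --> \oo] --> (0 : R).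
Proof.
rewrite /reg; have [_|_] := boolP (~~ a && (r == 1%N)).
  exact: cvg_psum1_addn_sub.
by under eq_fun do rewrite subrr; exact: cvg_cst.
Qed.

Lemma psum_bound a r n : (0 < r)%N -> `|psum a r n| <= L n.
Proof.
move=> r0; apply: le_trans (ler_norm_sum _ _ _) _.
rewrite growth_psum psum1E ler_wpDl //; apply: ler_sum => k _.
rewrite normrM norm_sgn mul1r ger0_norm ?exprn_ge0 //.
by rewrite ler_iXnr // invf_le1 // ler1n.
Qed.

(** The truncations [T N n] converge to [t n] and are bounded by a multiple of
    [1 + H_n], uniformly in [N].  The bound is limited to [n < N], since an
    integer [n] is a pole of the truncated kernel only then. *)
Definition tame (T : nat -> nat -> R) (t : nat -> R) :=
  (exists K, forall N n, (n < N)%N -> `|T N n| <= K * L n) /\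
  (forall n, T N n @[N --> \oo] --> t n).

Lemma tameD T t U u : tame T t -> tame U u ->
  tame (fun N n => T N n + U N n) (fun n => t n + u n).
Proof.
move=> [[K hK] Tt] [[K' hK'] Uu]; split=> [|n]; last exact: cvgD.
exists (K + K') => N n nN; rewrite mulrDl (le_trans (ler_normD _ _)) //.
by rewrite lerD ?hK ?hK'.
Qed.

Lemma tameZ c T t : tame T t -> tame (fun N n => c * T N n) (fun n => c * t n).
Proof.
move=> [[K hK] Tt]; split=> [|n]; last exact: cvgMl_tmp.
exists (`|c| * K) => N n nN; rewrite normrM -mulrA ler_wpM2l ?hK //.
Qed.

Lemma tame_psum a r : (0 < r)%N -> tame (fun _ n => psum a r n) (psum a r).
Proof.
move=> r0; split=> [|n]; last exact: cvg_cst.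
by exists 1 => N n _; rewrite mul1r psum_bound.
Qed.

Lemma tame_cst (c : R) : tame (fun _ _ => c) (fun=> c).
Proof.
split=> [|n]; last exact: cvg_cst.
by exists `|c| => N n _; rewrite ler_peMr // harmonic_growth_ge1.
Qed.

Lemma cvg_subnl n (u : nat -> R) (l : R) : u N @[N --> \oo] --> l ->
  u (N.-1 - n)%N @[N --> \oo] --> l.
Proof.
move=> ul; rewrite -cvg_shiftS /=.
by rewrite -(cvg_centern n) in ul; exact: ul.
Qed.

(** The sum and its regularization are truncated at different indices,
    [N.-1 - n] and [N]; the error consists of [n.+1] consecutive inverses, at
    most [H_{n+1}] in total and each tending to 0. *)
Lemma tame_tail a r : (0 < r)%N ->
  tame (fun N n => (-1) ^+ r * psum a r (N.-1 - n) + reg a r N)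
       (fun=> zeta_lim a r).
Proof.
move=> r0; have cG := cvg_psum_reg (a := a) r0.
have E N n : (n < N)%N -> (-1) ^+ r * psum a r (N.-1 - n) + reg a r N =
    ((-1) ^+ r * psum a r (N.-1 - n) + reg a r (N.-1 - n))
    + (reg a r ((N.-1 - n) + n.+1) - reg a r (N.-1 - n)).
  case: N => // N; rewrite ltnS => nN.
  by rewrite /= addnS subnK //; ring.
split=> [|n].
  have [K K0 hK] := cvg_bound cG.
  exists (K + 2) => N n nN; rewrite (E _ _ nN).
  apply: le_trans (ler_normD _ _) _; rewrite mulrDl lerD //.
    by apply: le_trans (hK _) _; rewrite ler_peMr // harmonic_growth_ge1.
  apply: le_trans (reg_addn_sub_bound _ _ _ _) _.
  rewrite psum1S; have := harmonic_growth_ge1 R n; rewrite growth_psum.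
  have : n.+1%:R^-1 <= 1 :> R by rewrite invf_le1 // ler1n.
  move: n.+1%:R^-1 (psum false 1 n) => x y h1 h2; lra.
rewrite -[X in _ --> X]addr0.
apply: (@cvg_trans _ ((((-1) ^+ r * psum a r (N.-1 - n) + reg a r (N.-1 - n))
    + (reg a r ((N.-1 - n) + n.+1) - reg a r (N.-1 - n))) @[N --> \oo])).
  by apply: near_eq_cvg; exists n.+1 => // N /= nN; rewrite -E.
apply: cvgD; first exact: (cvg_subnl n cG).
exact: (cvg_subnl n (cvg_reg_addn_sub a r n.+1)).
Qed.

Lemma tame_shift a r : (0 < r)%N ->
  tame (fun N n => (-1) ^+ r * psum a r (N + n) + reg a r N)
       (fun=> zeta_lim a r).
Proof.
move=> r0; have cG := cvg_psum_reg (a := a) r0.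
have E N n : (-1) ^+ r * psum a r (N + n) + reg a r N =
    ((-1) ^+ r * psum a r (N + n) + reg a r (N + n))
    - (reg a r (N + n) - reg a r N) by ring.
split=> [|n].
  have [K K0 hK] := cvg_bound cG.
  exists (K + 1) => N n nN; rewrite E.
  apply: le_trans (ler_normB _ _) _; rewrite mulrDl lerD //.
    by apply: le_trans (hK _) _; rewrite ler_peMr // harmonic_growth_ge1.
  apply: le_trans (reg_addn_sub_bound _ _ _ _) _.
  by rewrite growth_psum; lra.
rewrite -[X in _ --> X]subr0; under eq_fun do rewrite E.
apply: cvgB.
  by have := cG; rewrite -(cvg_shiftn n).
exact: cvg_reg_addn_sub.
Qed.

(** For [r = 1] without signs the two divergent halves have opposite signs, and
    so have their regularizations. *)
Lemma tame_two_sided a r : (0 < r)%N ->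
  tame (fun N n => psum a r (N + n) + (-1) ^+ r * psum a r (N.-1 - n))
       (fun=> (-1) ^+ r * zeta_lim a r + zeta_lim a r).
Proof.
move=> r0.
have E N n : psum a r (N + n) + (-1) ^+ r * psum a r (N.-1 - n) =
    (-1) ^+ r * ((-1) ^+ r * psum a r (N + n) + reg a r N)
    + ((-1) ^+ r * psum a r (N.-1 - n) + reg a r N).
  rewrite mulrDr mulrA -expr2 sqrr_sign mul1r addrACA.
  suff -> : (-1) ^+ r * reg a r N + reg a r N = 0 by rewrite addr0.
  rewrite /reg.
  have [/andP[_ /eqP->]|_] := boolP (~~ a && (r == 1%N)).
    by rewrite /= expr1 mulN1r addNr.
  by rewrite /= mulr0 addr0.
have -> : (fun N n => psum a r (N + n) + (-1) ^+ r * psum a r (N.-1 - n)) =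
    (fun N n => (-1) ^+ r * ((-1) ^+ r * psum a r (N + n) + reg a r N)
    + ((-1) ^+ r * psum a r (N.-1 - n) + reg a r N)).
  by apply: funext => N; apply: funext => n.
apply: tameD; last exact: tame_tail.
apply: tameZ; exact: tame_shift.
Qed.

End Regularization.

(** * The kernel and its expansions at its poles *)

Section Kernel.
Variables (R : realType) (D : nat).
Hypothesis D_gt0 : (0 < D)%N.
Implicit Types (a : bool) (m r n N : nat) (w : R).

Local Notation psum := (psum R).
Local Notation hsum := (hsum R).
Local Notation sgn := (sgn R).
Local Notation E := (@laurent R D).
Local Notation K m r := ((kappa D m r)%:~R : R).

Definition half : R := - 2^-1.

(** The regularized sum of [(+-1)^j / (s - j)^m] over [0 <= j < N],
    times [t^m]. *)
Definition pole_kernel a m N w : {poly R} :=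
  \sum_(0 <= j < N) sgn a j *: E w j%:R ^+ m + reg R a m N *: 'X ^+ m.

(** The sum of [(+-1)^k / (s - k)] over [-N <= k < N], times [t]: a truncation
    of [pi cot (pi s)] or [pi / sin (pi s)]. *)
Definition two_sided_kernel a N w : {poly R} :=
  \sum_(0 <= j < N) sgn a j *: E w j%:R ^+ 1 +
  \sum_(0 <= j < N) sgn a j.+1 *: E w (- j.+1%:R) ^+ 1.

(** [reg a r] vanishes for [r > 1] and [kappa m r] for [r < m], so the constant
    added to a kernel may be distributed over all its coefficients. *)
Lemma coef_reg a m r n N : (0 < m)%N ->
  reg R a m N * (r == m)%:R = sgn a n * (K m r * reg R a r N).
Proof.
move=> m0; have sr k : sgn a n * reg R a k N = reg R a k N.
  by rewrite /reg; case: (a); rewrite ?mulr0 //= sgn_false mul1r.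
rewrite mulrCA sr; have [->|rm] := eqVneq r m.
  by rewrite kappa_diag // mulr1 mul1r.
rewrite mulr0; move: rm; rewrite neq_ltn => /orP[rm|mr].
  by rewrite kappa_lt // mul0r.
rewrite /reg (gtn_eqF (leq_ltn_trans m0 mr)) andbF mulr0 //.
Qed.

Lemma sgn_sub a n k : (k <= n)%N -> sgn a (n - k) = sgn a n * sgn a k.
Proof. by move=> kn; rewrite -{2}(subnK kn) sgnD -mulrA sgnMM mulr1. Qed.

Lemma coef_pole_sum a m r n N : (0 < m)%N -> (n < N)%N ->
  (\sum_(0 <= j < N) sgn a j *: E n%:R j%:R ^+ m)`_r =
  sgn a n * ((r == 0%N)%:R +
    K m r * (psum a r n + (-1) ^+ r * psum a r (N.-1 - n))).
Proof.
move=> m0 nN; rewrite coef_sum.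
rewrite (big_cat_nat (n := n)) ?(ltnW nN) //= (big_ltn nN) coefZ.
rewrite coef_laurentX eqxx addrCA mulrDr; congr (_ + _).
rewrite !mulrDr mulrCA; congr (_ + _).
  (* the poles below n, counted by their distance to n *)
  rewrite /psum big_nat_rev /= add0n 2!big_distrr /=.
  rewrite big_nat_cond [RHS]big_nat_cond.
  apply: eq_bigr => j; rewrite andbT => /andP[_ jn].
  rewrite coefZ coef_laurentX eqr_nat.
  rewrite gtn_eqF ?ltn_subrL ?(leq_ltn_trans _ jn) //.
  rewrite natrB // subKr sgn_sub //; ring.
(* the poles above n, where the distance enters with a sign *)
rewrite -{1}[n.+1]add0n big_addn /psum !big_distrr /= subnS -predn_sub.
have -> : (N - n).-1 = (N.-1 - n)%N by rewrite -!subn1 -!subnDA addnC.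
apply: eq_bigr => j _.
rewrite coefZ coef_laurentX eqr_nat ltn_eqF ?leq_addl //.
have -> : n%:R - (j + n.+1)%:R = - j.+1%:R :> R.
  by rewrite natrD -[n.+1%:R]natr1 -[j.+1%:R]natr1; ring.
rewrite addnS -addSn addnC sgnD invrN (exprNn j.+1%:R^-1); ring.
Qed.

Lemma coef_pole_kernel_nat a m r n N : (0 < m)%N -> (n < N)%N ->
  (pole_kernel a m N n%:R)`_r = sgn a n * ((r == 0%N)%:R + K m r *
    (psum a r n + ((-1) ^+ r * psum a r (N.-1 - n) + reg R a r N))).
Proof.
move=> m0 nN; rewrite coefD coef_pole_sum // coefZ coefXn (coef_reg a r n) //.
by ring.
Qed.

Lemma coef_two_sided_kernel_nat a r n N : (n < N)%N ->
  (two_sided_kernel a N n%:R)`_r = sgn a n * ((r == 0%N)%:R +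
    K 1 r * (psum a r (N + n) + (-1) ^+ r * psum a r (N.-1 - n))).
Proof.
move=> nN; rewrite coefD coef_pole_sum //.
have -> : psum a r (N + n) = psum a r n +
    \sum_(0 <= j < N) sgn a (n + j.+1) * (n + j.+1)%:R^-1 ^+ r.
  rewrite /psum (big_cat_nat (n := n)) ?leq_addl //=; congr (_ + _).
  rewrite -{1}[n]add0n big_addn addnK; apply: eq_bigr => j _.
  by rewrite addnS addnC.
rewrite coef_sum (eq_bigr (fun j => sgn a n * K 1 r *
  (sgn a (n + j.+1) * (n + j.+1)%:R^-1 ^+ r))) => [|j _].
  by rewrite -big_distrr /=; ring.
rewrite coefZ coef_laurentX -subr_eq0 opprK -natrD pnatr_eq0 addnS /=.
by rewrite -addnS sgnD; have := sgnMM R a n; set x := sgn a n => xx; ring: xx.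
Qed.

Lemma coef_pole_kernel_neg a m r n N : (0 < m)%N ->
  (pole_kernel a m N (- n.+1%:R))`_r = sgn a n.+1 * (K m r *
    (- (-1) ^+ r * psum a r n + ((-1) ^+ r * psum a r (N + n) + reg R a r N))).
Proof.
move=> m0; rewrite coefD coefZ coefXn (coef_reg a r n.+1) //.
have -> : psum a r (N + n) = psum a r n +
    \sum_(0 <= j < N) sgn a (n.+1 + j) * (n.+1 + j)%:R^-1 ^+ r.
  rewrite /psum (big_cat_nat (n := n)) ?leq_addl //=; congr (_ + _).
  rewrite -{1}[n]add0n big_addn addnK; apply: eq_bigr => j _.
  by rewrite addSn addnC.
rewrite coef_sum (eq_bigr (fun j => sgn a n.+1 * (K m r * (-1) ^+ r) *
  (sgn a (n.+1 + j) * (n.+1 + j)%:R^-1 ^+ r))) => [|j _].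
  by rewrite -big_distrr /=; ring.
rewrite coefZ coef_laurentX eq_sym -subr_eq0 opprK -natrD pnatr_eq0 addnS /=.
rewrite -opprD -natrD invrN (exprNn (n.+1 + j)%:R^-1) sgnD.
by have := sgnMM R a n.+1; set x := sgn a n.+1 => xx; ring: xx.
Qed.

Lemma coef0_two_sided_kernel_neg a n N : (n < N)%N ->
  (two_sided_kernel a N (- n.+1%:R))`_0 = sgn a n.+1.
Proof.
move=> nN; rewrite coefD !coef_sum big1 => [|j _]; last first.
  rewrite coefZ coef_laurentX eq_sym -subr_eq0 opprK -natrD pnatr_eq0 addnS /=.
  by rewrite kappa_lt // mul0r mulr0.
rewrite add0r (bigD1_seq n) ?mem_index_iota ?iota_uniq //=.
rewrite coefZ coef_laurentX !eqxx /= mulr1 big1 ?addr0 // => j jn.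
rewrite coefZ coef_laurentX eqr_opp eqr_nat eqSS eq_sym (negbTE jn).
by rewrite kappa_lt // mul0r mulr0.
Qed.

Lemma half_neq_nat n : (half == n%:R) = false.
Proof.
apply/negbTE; rewrite lt_eqF // (lt_le_trans _ (ler0n _ _)) //.
by rewrite oppr_lt0 invr_gt0.
Qed.

Lemma half_neq_neg n : (half == - n.+1%:R) = false.
Proof.
apply/negbTE; rewrite eqr_opp lt_eqF // (@lt_le_trans _ _ 1) ?ler1n //.
by rewrite invf_lt1 // ltr1n.
Qed.

Lemma coef_pole_sum_half a m r N :
  (\sum_(0 <= j < N) sgn a j *: E half j%:R ^+ m)`_r =
  K m r * ((-1) ^+ r * hsum a r N).
Proof.
rewrite coef_sum /hsum !big_distrr /=; apply: eq_bigr => j _.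
by rewrite coefZ coef_laurentX half_neq_nat -opprD addrC invrN
  (exprNn (j%:R + 2^-1)^-1); ring.
Qed.

Lemma coef_pole_kernel_half a m r N : (0 < m)%N ->
  (pole_kernel a m N half)`_r =
    K m r * ((-1) ^+ r * hsum a r N + reg R a r N).
Proof.
move=> m0; rewrite coefD coef_pole_sum_half coefZ coefXn (coef_reg a r 0) //.
by rewrite /sgn expr0; ring.
Qed.

(** The poles [j] and [- j - 1] are symmetric about [- 1/2], hence contribute
    equally up to sign.  The factor [1 + (-1)^r (-1)^a] is 0 in the divergent
    case, so the regularization may be inserted. *)
Lemma coef_two_sided_kernel_half a r N :
  (two_sided_kernel a N half)`_r = K 1 r * ((1 + (-1) ^+ r * (-1) ^+ a) *
    ((-1) ^+ r * hsum a r N + reg R a r N)).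
Proof.
rewrite coefD coef_pole_sum_half.
have -> : (\sum_(0 <= j < N) sgn a j.+1 *: E half (- j.+1%:R) ^+ 1)`_r
    = K 1 r * (-1) ^+ a * hsum a r N.
  rewrite coef_sum /hsum !big_distrr /=; apply: eq_bigr => j _.
  rewrite coefZ coef_laurentX half_neq_neg opprK sgnS.
  have -> : half + j.+1%:R = j%:R + 2^-1 by rewrite /half -[j.+1%:R]natr1; lra.
  ring.
(* a regularization is present only for r = 1 without signs *)
have reg0 : (1 + (-1) ^+ r * (-1) ^+ a) * reg R a r N = 0.
  rewrite /reg; have [/andP[na /eqP->]|_] := boolP (~~ a && (r == 1%N)).
    by rewrite (negbTE na) /= expr0 expr1 mulN1r subrr mul0r.
  by rewrite mulr0.
rewrite mulrDr reg0 addr0.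
have := sqrr_sign R r; rewrite expr2 => s2.
by ring: s2.
Qed.

Lemma coef_laurent_half_nat q r n :
  (E n%:R half ^+ q)`_r = K q r * (n%:R + 2^-1)^-1 ^+ r.
Proof. by rewrite coef_laurentX eq_sym half_neq_nat opprK. Qed.

Lemma coef_laurent_half_neg q r n :
  (E (- n.+1%:R) half ^+ q)`_r = K q r * ((-1) ^+ r * (n%:R + 2^-1)^-1 ^+ r).
Proof.
rewrite coef_laurentX eq_sym half_neq_neg.
have -> : - n.+1%:R - half = - (n%:R + 2^-1).
  by rewrite /half -[n.+1%:R]natr1; lra.
by rewrite invrN (exprNn (n%:R + 2^-1)^-1).
Qed.

Lemma laurent_half_half q : E half half ^+ q = 1.
Proof. by rewrite /laurent eqxx expr1n. Qed.

(** [F_N] times [t^(m+p+1+q)]; its coefficient of index [m + p + q] is the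
    residue at [w]. *)
Definition kernel a b g m p q N w : {poly R} :=
  pole_kernel a m N w * pole_kernel b p N w * two_sided_kernel g N w
  * E w half ^+ q.

Lemma sum_kernel_residues a b g m p q N : D = (m + p + q)%N -> (0 < q)%N ->
  (kernel a b g m p q N half)`_D + \sum_(0 <= n < N)
    ((kernel a b g m p q N n%:R)`_D + (kernel a b g m p q N (- n.+1%:R))`_D)
  = 0.
Proof.
move=> eD q0.
pose Om := half :: [seq n%:R | n <- index_iota 0 N]
                ++ [seq - n.+1%:R | n <- index_iota 0 N].
have Om_uniq : uniq Om.
  rewrite /= mem_cat negb_or cat_uniq; apply/andP; split.
    apply/andP; split; apply/negP => /mapP[n _] /eqP.
      by rewrite half_neq_nat.
    by rewrite half_neq_neg.
  apply/and3P; split.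
  - by rewrite map_inj_uniq ?iota_uniq // => i j /eqP; rewrite eqr_nat => /eqP.
  - apply/hasPn => _ /mapP[n _ ->]; apply/negP => /mapP[k _] /eqP.
    by rewrite eq_sym -subr_eq0 opprK -natrD pnatr_eq0 addnS.
  - rewrite map_inj_uniq ?iota_uniq // => i j /eqP.
    by rewrite eqr_opp eqr_nat eqSS => /eqP.
have natOm j : j \in index_iota 0 N -> j%:R \in Om.
  by move=> jN; rewrite inE mem_cat map_f ?orbT.
have negOm j : j \in index_iota 0 N -> - j.+1%:R \in Om.
  move=> jN; rewrite inE mem_cat orbA; apply/orP; right.
  by apply: (map_f (fun n => - n.+1%:R)).
have halfOm : half \in Om by rewrite mem_head.
have span_pole c k : pf_span D Om k 0 (pole_kernel c k N).
  have := PfDZ (reg R c k N)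
    (_ : pf_span D Om k 0 (fun=> 'X ^+ k))
    (_ : pf_span D Om k 0
       (fun w => \sum_(0 <= j < N) sgn c j *: E w j%:R ^+ k)).
  move=> h; apply: (pf_span_ext (h _ _)) => [||w]; last by rewrite addrC.
    apply: (@PfProd _ _ _ [::] k) => // w.
    by rewrite big_nil mulr1.
  apply: pf_span_sum => j /natOm jO.
  exact: PfWeaken (pf_span_laurentX _ _ jO) _.
have span_two : pf_span D Om 1 1 (two_sided_kernel g N).
  have := PfDZ 1
    (_ : pf_span D Om 1 1
       (fun w => \sum_(0 <= j < N) sgn g j *: E w j%:R ^+ 1))
    (_ : pf_span D Om 1 1
       (fun w => \sum_(0 <= j < N) sgn g j.+1 *: E w (- j.+1%:R) ^+ 1)).
  move=> h; apply: (pf_span_ext (h _ _)) => [||w]; last by rewrite scale1r.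
    by apply: pf_span_sum => j /natOm jO; exact: pf_span_laurentX.
  by apply: pf_span_sum => j /negOm jO; exact: pf_span_laurentX.
have span := pf_spanM (pf_spanM (pf_spanM (span_pole a m) (span_pole b p))
  span_two) (pf_span_laurentX _ q halfOm).
have eD1 : (m + p + 1 + q)%N = D.+1 by rewrite eD addn1.
rewrite eD1 in span; rewrite -[RHS](sum_residues Om_uniq span) //.
by rewrite big_cons big_cat /= !big_map -big_split.
Qed.

End Kernel.

(** * Passage to the limit in the sum of residues *)

Lemma coefM4 (S : comNzRingType) (p1 p2 p3 p4 : {poly S}) d :
  (p1 * p2 * p3 * p4)`_d = \sum_(i < d.+1) \sum_(j < i.+1) \sum_(k < j.+1)
    p1`_k * p2`_(j - k) * p3`_(i - j) * p4`_(d - i).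
Proof.
rewrite coefM; apply: eq_bigr => i _; rewrite coefM big_distrl /=.
apply: eq_bigr => j _; rewrite coefM !big_distrl /=; exact: eq_bigr.
Qed.

Lemma coefM_low (S : comNzRingType) (p q : {poly S}) m k :
    (forall i, (i < m)%N -> p`_i = 0) -> (forall i, (i < k)%N -> q`_i = 0) ->
  (forall i, (i < m + k)%N -> (p * q)`_i = 0) /\
  (p * q)`_(m + k) = p`_m * q`_k.
Proof.
move=> p0 q0; split=> [i im|].
  rewrite coefM big1 // => j _; case: (ltnP j m) => jm.
    by rewrite p0 // mul0r.
  have ji : (j <= i)%N by rewrite -ltnS ltn_ord.
  rewrite q0 ?mulr0 // ltn_subLR //.
  by rewrite (leq_trans im) // leq_add2r.
have mk : (m < (m + k).+1)%N by rewrite ltnS leq_addr.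
rewrite coefM (bigD1 (Ordinal mk)) //= big1 ?addr0 => [|j jm].
  by rewrite addKn.
case: (ltnP j m) => jm'; first by rewrite p0 // mul0r.
have jmk : (j <= m + k)%N by rewrite -ltnS ltn_ord.
rewrite q0 ?mulr0 // ltn_subLR // ltn_add2r.
by rewrite ltn_neqAle jm' andbT eq_sym.
Qed.

Section Conclusion.
Variable R : realType.

Local Notation psum := (psum R).
Local Notation hsum := (hsum R).
Local Notation sgn := (sgn R).
Local Notation L := (harmonic_growth R).
Local Notation weight l n := ((n%:R + 2^-1 : R)^-1 ^+ l).

Definition cvred (u : nat -> R) :=
  exists2 l : R, l \in reducibles R & u n @[n --> \oo] --> l.

Lemma cvredD u v : cvred u -> cvred v -> cvred (fun n => u n + v n).
Proof.
by move=> [l hl ul] [k hk vk]; exists (l + k); [rewrite rpredD|exact: cvgD].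
Qed.

Lemma cvredM u v : cvred u -> cvred v -> cvred (fun n => u n * v n).
Proof.
by move=> [l hl ul] [k hk vk]; exists (l * k); [rewrite rpredM|exact: cvgM].
Qed.

Lemma cvred_cst c : c \in reducibles R -> cvred (fun=> c).
Proof. by move=> hc; exists c => //; exact: cvg_cst. Qed.

Lemma cvred0 : cvred (fun=> 0).
Proof. by apply: cvred_cst; exact: rpred0. Qed.

Lemma cvred_sum (I : Type) (r : seq I) (F : I -> nat -> R) :
  (forall i, cvred (F i)) -> cvred (fun n => \sum_(i <- r) F i n).
Proof.
move=> hF; elim: r => [|i r IH].
  by under eq_fun do rewrite big_nil; exact: cvred0.
by under eq_fun do rewrite big_cons; exact: cvredD.
Qed.

Lemma cvred_coefM (p q : nat -> {poly R}) :
  (forall r, cvred (fun n => (p n)`_r)) ->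
  (forall r, cvred (fun n => (q n)`_r)) ->
  forall r, cvred (fun n => (p n * q n)`_r).
Proof.
move=> hp hq r; under eq_fun do rewrite coefM.
by apply: cvred_sum => i; exact: cvredM.
Qed.

Section HalfResidue.
Variable D : nat.
Hypothesis D_gt0 : (0 < D)%N.

Lemma cvred_pole_kernel_half a m r : (0 < m)%N ->
  cvred (fun N => (pole_kernel D a m N (half R))`_r).
Proof.
move=> m0; under eq_fun do rewrite coef_pole_kernel_half //.
case: r => [|r].
  by under eq_fun do rewrite kappa_lt // mul0r; exact: cvred0.
apply: cvredM; first by apply: cvred_cst; rewrite rpred_int.
by exists (half_lim R a r.+1); [exact: half_lim_red|exact: cvg_hsum_reg].
Qed.

Lemma cvred_two_sided_kernel_half a r :
  cvred (fun N => (two_sided_kernel D a N (half R))`_r).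
Proof.
under eq_fun do rewrite coef_two_sided_kernel_half.
case: r => [|r].
  by under eq_fun do rewrite kappa_lt // mul0r; exact: cvred0.
apply: cvredM; first by apply: cvred_cst; rewrite rpred_int.
apply: cvredM.
  by apply: cvred_cst; rewrite rpredD ?rpred1 // rpredM ?rpredX ?rpredN1.
by exists (half_lim R a r.+1); [exact: half_lim_red|exact: cvg_hsum_reg].
Qed.

Lemma cvred_kernel_half a b g m p q r : (0 < m)%N -> (0 < p)%N ->
  cvred (fun N => (kernel D a b g m p q N (half R))`_r).
Proof.
move=> m0 p0; rewrite /kernel laurent_half_half.
apply: cvred_coefM => {}r; last by apply: cvred_cst; rewrite coef1 rpred_nat.
apply: cvred_coefM => {}r; last exact: cvred_two_sided_kernel_half.
by apply: cvred_coefM => {}r; exact: cvred_pole_kernel_half.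
Qed.

End HalfResidue.

(** Pointwise convergence with a majorant as [tannery] requires. *)
Definition dominated (T : nat -> nat -> R) (t : nat -> R) :=
  (exists C, forall N n, (n < N)%N ->
     `|T N n| <= C * (L n ^+ 3 * n.+1%:R^-1 ^+ 2)) /\
  (forall n, T N n @[N --> \oo] --> t n).

Lemma dominatedD T t U u : dominated T t -> dominated U u ->
  dominated (fun N n => T N n + U N n) (fun n => t n + u n).
Proof.
move=> [[K hK] Tt] [[K' hK'] Uu]; split=> [|n]; last exact: cvgD.
exists (K + K') => N n nN; rewrite mulrDl (le_trans (ler_normD _ _)) //.
by rewrite lerD ?hK ?hK'.
Qed.

Lemma dominated0 : dominated (fun _ _ => 0) (fun=> 0).
Proof.
split=> [|n]; last exact: cvg_cst.
by exists 0 => N n _; rewrite mul0r normr0.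
Qed.

Lemma dominated_sum (I : Type) (r : seq I) (T : I -> nat -> nat -> R)
    (t : I -> nat -> R) :
  (forall i, dominated (T i) (t i)) ->
  dominated (fun N n => \sum_(i <- r) T i N n) (fun n => \sum_(i <- r) t i n).
Proof.
move=> Tt; elim: r => [|i r IH].
  under [X in dominated X _]eq_fun do under eq_fun do rewrite big_nil.
  under [X in dominated _ X]eq_fun do rewrite big_nil.
  exact: dominated0.
under [X in dominated X _]eq_fun do under eq_fun do rewrite big_cons.
under [X in dominated _ X]eq_fun do rewrite big_cons.
exact: dominatedD.
Qed.

Lemma weight_bound l n : (2 <= l)%N ->
  `|weight l n| <= 2 ^+ l * n.+1%:R^-1 ^+ 2.
Proof.
have w0 : 0 <= (n%:R + 2^-1 : R)^-1 by rewrite invr_ge0 ltW ?half_gt0.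
move=> l2; rewrite ger0_norm ?exprn_ge0 //.
apply: (@le_trans _ _ ((2 * n.+1%:R^-1) ^+ l)).
  by rewrite lerXn2r ?nnegrE ?mulr_ge0 // inv_half_le.
rewrite exprMn; apply: ler_wpM2l; first exact: exprn_ge0.
by rewrite ler_wiXn2l // invf_le1 // ler1n.
Qed.

Lemma dominatedM A x B y C z l : (2 <= l)%N ->
  tame A x -> tame B y -> tame C z ->
  dominated (fun N n => A N n * B N n * C N n * weight l n)
            (fun n => x n * y n * z n * weight l n).
Proof.
move=> l2 [[KA hA] Ax] [[KB hB] By] [[KC hC] Cz]; split=> [|n]; last first.
  by apply: cvgM; [apply: cvgM; [exact: cvgM|]|exact: cvg_cst].
exists (KA * KB * KC * 2 ^+ l) => N n nN; rewrite !normrM.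
have -> : KA * KB * KC * 2 ^+ l * (L n ^+ 3 * n.+1%:R^-1 ^+ 2) =
  KA * L n * (KB * L n) * (KC * L n) * (2 ^+ l * n.+1%:R^-1 ^+ 2) by ring.
by rewrite !ler_pM ?mulr_ge0 ?hA ?hB ?hC ?weight_bound.
Qed.

Section Good.
Variable e : bool.

Definition redseries (f : nat -> R) := cvred (series (fun n => sgn e n * f n)).

Lemma redseries_ext f h : redseries f -> f =1 h -> redseries h.
Proof. by move=> + fh; have -> : h = f by apply: funext => n; rewrite fh. Qed.

Lemma redseriesD f h :
  redseries f -> redseries h -> redseries (fun n => f n + h n).
Proof.
move=> gf gh; rewrite /redseries.
have -> : series (fun n => sgn e n * (f n + h n)) =
  (fun N => series (fun n => sgn e n * f n) N
            + series (fun n => sgn e n * h n) N).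
  apply: funext => N; rewrite /series /= -big_split /=.
  by apply: eq_bigr => n _; rewrite mulrDr.
exact: cvredD.
Qed.

Lemma redseriesZ c f :
  c \in reducibles R -> redseries f -> redseries (fun n => c * f n).
Proof.
move=> hc gf; rewrite /redseries.
have -> : series (fun n => sgn e n * (c * f n)) =
  (fun N => c * series (fun n => sgn e n * f n) N).
  apply: funext => N; rewrite /series /= big_distrr /=.
  by apply: eq_bigr => n _; rewrite mulrCA.
by apply: cvredM => //; exact: cvred_cst.
Qed.

Lemma redseries_sum (I : Type) (r : seq I) (F : I -> nat -> R) :
  (forall i, redseries (F i)) -> redseries (fun n => \sum_(i <- r) F i n).
Proof.
move=> hF; elim: r => [|i r IH].
  rewrite /redseries.
  have -> : series (fun n => sgn e n * \sum_(i <- [::]) F i n) = fun=> 0.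
    apply: funext => N; rewrite /series /= big1 // => n _.
    by rewrite big_nil mulr0.
  exact: cvred0.
by apply: (redseries_ext (redseriesD (hF i) IH)) => n; rewrite big_cons.
Qed.

Lemma redseries_weight l : (2 <= l)%N -> redseries (fun n => weight l n).
Proof.
move=> l2; have l0 := ltnW l2.
exists (if e then - Rbar R l else Rval R l).
  by case: (e); rewrite ?rpredN; apply: reducibles_generator; right;
    [exact: Single_Rbar|exact: Single_R].
by apply: lim_hsum; rewrite // l2 orbT.
Qed.

Lemma cvg_linear a k l : (0 < k)%N -> (2 <= l)%N ->
  cvgn (series (fun n => sgn e n * (psum a k n * weight l n))).
Proof.
move=> k0 l2; apply: (cvg_dominated (g := 2 ^+ l *:
    (fun n => L n ^+ 3 * n.+1%:R^-1 ^+ 2))); last first.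
  by apply: is_cvg_seriesZ; exact: cvg_harmonic_growth3.
move=> n; rewrite !normrM norm_sgn mul1r.
have L1 := harmonic_growth_ge1 R n.
apply: (@le_trans _ _ (L n * (2 ^+ l * n.+1%:R^-1 ^+ 2))).
  by rewrite ler_pM // ?psum_bound ?weight_bound.
rewrite /GRing.scale /= mulrCA ler_wpM2l // ler_wpM2r ?exprn_ge0 //.
by rewrite ler_eXnr.
Qed.

(** These are the linear sums, up to the sign in [psum true = - Hbar]. *)
Lemma redseries_linear a k l : (0 < k)%N -> (2 <= l)%N ->
  redseries (fun n => psum a k n * weight l n).
Proof.
move=> k0 l2; have cl := cvg_linear (a := a) k0 l2.
pose f n : R := (if a then Hbar R k n else H R k n) * sgn e n.
have E : series (fun n => sgn e n * (psum a k n * weight l n)) =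
    (-1) ^+ a *: series (Rterm f l).
  rewrite -seriesZ; congr series; apply: funext => n.
  rewrite /GRing.scale /= /Rterm /f -exprVn.
  case: (a); rewrite /= ?Hbar_psum ?H_psum ?expr0 ?expr1;
    rewrite -[RHS]/(_ * _); ring.
have lin : linear_Rsum (Rsum f l).
  rewrite /f; case: (e); case: (a).
  - exact: Linear_Hbar_alt.
  - exact: Linear_H_alt.
  - under eq_fun do rewrite sgn_false mulr1; exact: Linear_Hbar.
  - under eq_fun do rewrite sgn_false mulr1; exact: Linear_H.
exists (limn (series (fun n => sgn e n * (psum a k n * weight l n)))) => //.
have cf : cvgn (series (Rterm f l)).
  have -> : series (Rterm f l) =
      (-1) ^+ a *: series (fun n => sgn e n * (psum a k n * weight l n)).
    by rewrite E scalerA -expr2 sqrr_sign scale1r.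
  exact: is_cvgZr.
rewrite E limZr // rpredM ?rpred_sign //.
by apply: reducibles_generator; left.
Qed.

Lemma redseries_affine a k l x y z :
  x \in reducibles R -> y \in reducibles R -> z \in reducibles R ->
  (0 < k)%N -> (2 <= l)%N ->
  redseries (fun n => z * (x + y * psum a k n) * weight l n).
Proof.
move=> hx hy hz k0 l2.
have g1 := redseriesZ (rpredM hz hx) (redseries_weight l2).
have g2 := redseriesZ (rpredM hz hy) (redseries_linear a k0 l2).
by apply: (redseries_ext (redseriesD g1 g2)) => n; ring.
Qed.

End Good.


Section Quadratic.
Variables (m p q : nat) (a b : bool).
Hypotheses (m0 : (0 < m)%N) (p0 : (0 < p)%N) (q2 : (1 < q)%N).

Let D := (m + p + q)%N.
Let e := odd D.
(* The sign of the two-sided kernel is chosen so that the three signs multiply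
   to [(-1)^(e n)]. *)
Let g := a (+) b (+) e.

Let D_gt0 : (0 < D)%N.
Proof. by rewrite /D -addnA ltn_addr. Qed.

Local Notation K i r := ((kappa D i r)%:~R : R).

Let quad n : R := psum a m n * psum b p n * weight q n.

Lemma sgn_abg n : sgn a n * sgn b n * sgn g n = sgn e n.
Proof.
have sgnX c d : sgn c n * sgn d n = sgn (c (+) d) n.
  by rewrite /sgn -exprMn signr_addb.
by rewrite !sgnX /g addKb.
Qed.

Definition pole_coef c i r N n : R := (r == 0%N)%:R + K i r *
  (psum c r n + ((-1) ^+ r * psum c r (N.-1 - n) + reg R c r N)).

Definition pole_coef_lim c i r n : R :=
  (r == 0%N)%:R + K i r * (psum c r n + zeta_lim R c r).

Lemma tame_pole_coef c i r : (0 < i)%N ->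
  tame (pole_coef c i r) (pole_coef_lim c i r).
Proof.
move=> i0; case: r => [|r].
  have -> : pole_coef c i 0 = fun _ _ => 1.
    by apply: funext => N; apply: funext => n;
      rewrite /pole_coef kappa_lt // mul0r addr0.
  have -> : pole_coef_lim c i 0 = fun=> 1.
    by apply: funext => n; rewrite /pole_coef_lim kappa_lt // mul0r addr0.
  exact: tame_cst.
apply: tameD; first exact: tame_cst.
apply: tameZ; apply: tameD; first exact: tame_psum.
exact: tame_tail.
Qed.

Definition two_sided_coef r N n : R := (r == 0%N)%:R + K 1 r *
  (psum g r (N + n) + (-1) ^+ r * psum g r (N.-1 - n)).

Definition two_sided_coef_lim r : R := (r == 0%N)%:R + K 1 r *
  ((-1) ^+ r * zeta_lim R g r + zeta_lim R g r).

Lemma tame_two_sided_coef r :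
  tame (two_sided_coef r) (fun=> two_sided_coef_lim r).
Proof.
case: r => [|r].
  have -> : two_sided_coef 0 = fun _ _ => 1.
    by apply: funext => N; apply: funext => n;
      rewrite /two_sided_coef kappa_lt // mul0r addr0.
  rewrite /two_sided_coef_lim kappa_lt // mul0r addr0; exact: tame_cst.
apply: tameD; first exact: tame_cst.
apply: tameZ; exact: tame_two_sided.
Qed.

Lemma two_sided_coef_lim_red r : two_sided_coef_lim r \in reducibles R.
Proof.
rewrite /two_sided_coef_lim; case: r => [|r].
  by rewrite kappa_lt // mul0r addr0 rpred_nat.
have z := zeta_lim_red R g (ltn0Sn r).
by rewrite rpredD ?rpred_nat // rpredM ?rpred_int // rpredD // rpredM ?rpredX
  ?rpredN1.
Qed.

Definition residue_term k j i l N n : R :=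
  pole_coef a m k N n * pole_coef b p j N n * two_sided_coef i N n
  * (K q l * weight l n).

Definition residue_term_lim k j i l n : R :=
  pole_coef_lim a m k n * pole_coef_lim b p j n * two_sided_coef_lim i
  * (K q l * weight l n).

Lemma dominated_residue_term k j i l :
  dominated (residue_term k j i l) (residue_term_lim k j i l).
Proof.
have [lq|ql] := ltnP l q.
  have -> : residue_term k j i l = fun _ _ => 0.
    by apply: funext => N; apply: funext => n;
      rewrite /residue_term kappa_lt // mul0r mulr0.
  have -> : residue_term_lim k j i l = fun=> 0.
    by apply: funext => n; rewrite /residue_term_lim kappa_lt // mul0r mulr0.
  exact: dominated0.
have h := dominatedM (leq_trans q2 ql) (tame_pole_coef a k m0)
  (tame_pole_coef b j p0) (tameZ (K q l) (tame_two_sided_coef i)).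
have -> : residue_term k j i l = (fun N n => pole_coef a m k N n *
    pole_coef b p j N n * (K q l * two_sided_coef i N n) * weight l n).
  by apply: funext => N; apply: funext => n; rewrite /residue_term; ring.
have -> : residue_term_lim k j i l = (fun n => pole_coef_lim a m k n *
    pole_coef_lim b p j n * (K q l * two_sided_coef_lim i) * weight l n).
  by apply: funext => n; rewrite /residue_term_lim; ring.
exact: h.
Qed.

Lemma redseries0 : redseries e (fun=> 0).
Proof.
apply: (redseries_ext (redseriesZ (rpred0 _) (redseries_weight e q2))) => n.
by rewrite mul0r.
Qed.

Lemma redseries_pole_coef_lim c i r z l :
  (0 < i)%N -> z \in reducibles R -> (2 <= l)%N ->
  redseries e (fun n => z * pole_coef_lim c i r n * weight l n).
Proof.
move=> i0 hz l2; case: r => [|r].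
  apply: (redseries_ext (redseriesZ hz (redseries_weight e l2))) => n.
  by rewrite /pole_coef_lim kappa_lt // mul0r addr0 mulr1.
have red_x : K i r.+1 * zeta_lim R c r.+1 \in reducibles R.
  by rewrite rpredM ?rpred_int ?zeta_lim_red.
have red_y : K i r.+1 \in reducibles R by rewrite rpred_int.
apply: (redseries_ext (redseries_affine e c red_x red_y hz (ltn0Sn r) l2)) => n.
by rewrite /pole_coef_lim /=; ring.
Qed.

(** If [l < q] the term vanishes.  If [k < m] or [j < p], only the polar part of
    [A] or [B] can contribute and at most one harmonic number remains.
    Otherwise the three exponents already exhaust the degree [m + p + q], so
    that [i = 0], the pole of [C] is taken, and the product of the two harmonic
    numbers appears with coefficient 1. *)
Lemma redseries_residue_term k j i l : (k + j + i + l)%N = D ->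
  redseries e (fun n => residue_term_lim k j i l n - (k == m)%:R * (j == p)%:R
    * (i == 0%N)%:R * (l == q)%:R * quad n).
Proof.
move=> eD.
have [lq|ql] := ltnP l q.
  apply: (redseries_ext redseries0) => n; rewrite /residue_term_lim kappa_lt //.
  by rewrite (ltn_eqF lq) mulr0n !(mul0r, mulr0) subrr.
have l2 := leq_trans q2 ql.
have red_w : two_sided_coef_lim i * K q l \in reducibles R.
  by rewrite rpredM ?two_sided_coef_lim_red ?rpred_int.
have [km|mk] := ltnP k m.
  have z_red : (k == 0%N)%:R * (two_sided_coef_lim i * K q l) \in reducibles R.
    by rewrite rpredM // rpred_nat.
  apply: (redseries_ext (redseries_pole_coef_lim b j p0 z_red l2)) => n.
  rewrite (ltn_eqF km) mulr0n !mul0r subr0 /residue_term_lim.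
  rewrite [pole_coef_lim a m k n]/pole_coef_lim (kappa_lt D km) mul0r addr0.
  ring.
have [jp|pj] := ltnP j p.
  have z_red : (j == 0%N)%:R * (two_sided_coef_lim i * K q l) \in reducibles R.
    by rewrite rpredM // rpred_nat.
  apply: (redseries_ext (redseries_pole_coef_lim a k m0 z_red l2)) => n.
  rewrite (ltn_eqF jp) mulr0n mulr0 !mul0r subr0 /residue_term_lim.
  rewrite [pole_coef_lim b p j n]/pole_coef_lim (kappa_lt D jp) mul0r addr0.
  ring.
have [-> -> -> ->] : [/\ k = m, j = p, i = 0%N & l = q].
  by move: eD; rewrite /D; split; lia.
have za := zeta_lim_red R a m0; have zb := zeta_lim_red R b p0.
have g1 := redseries_affine e b (rpredM za zb) za (rpred1 _) p0 q2.
have g2 := redseriesZ zb (redseries_linear e a m0 q2).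
apply: (redseries_ext (redseriesD g1 g2)) => n.
rewrite /residue_term_lim /two_sided_coef_lim /pole_coef_lim !kappa_diag //.
rewrite (kappa_lt D (_ : 0 < 1)%N) // !eqxx (gtn_eqF m0) (gtn_eqF p0) /quad /=.
ring.
Qed.

Definition nat_residue N n : R :=
  \sum_(i < D.+1) \sum_(j < i.+1) \sum_(k < j.+1)
    residue_term k (j - k)%N (i - j)%N (D - i)%N N n.

Definition nat_residue_lim n : R :=
  \sum_(i < D.+1) \sum_(j < i.+1) \sum_(k < j.+1)
    residue_term_lim k (j - k)%N (i - j)%N (D - i)%N n.

Lemma kernel_nat N n : (n < N)%N ->
  (kernel D a b g m p q N n%:R)`_D = sgn e n * nat_residue N n.
Proof.
move=> nN; rewrite coefM4 -sgn_abg /nat_residue big_distrr /=.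
apply: eq_bigr => i _; rewrite big_distrr /=; apply: eq_bigr => j _.
rewrite big_distrr /=; apply: eq_bigr => k _.
rewrite !coef_pole_kernel_nat // coef_two_sided_kernel_nat //.
rewrite coef_laurent_half_nat.
rewrite -/(pole_coef a m k N n) -/(pole_coef b p (j - k)%N N n).
rewrite -/(two_sided_coef (i - j)%N N n) /residue_term; ring.
Qed.

Lemma dominated_nat_residue : dominated nat_residue nat_residue_lim.
Proof.
do 3!apply: dominated_sum => ?; exact: dominated_residue_term.
Qed.

(** In the expansion of the residue exactly one quadruple of exponents yields
    [quad]: the indicator of that quadruple is the coefficient of the product of
    the four monomials. *)
Lemma redseries_nat_residue : redseries e (fun n => nat_residue_lim n - quad n).
Proof.
have one : 1 = \sum_(i < D.+1) \sum_(j < i.+1) \sum_(k < j.+1)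
   (((k : nat) == m)%:R * ((j - k)%N == p)%:R * ((i - j)%N == 0%N)%:R
    * ((D - i)%N == q)%:R) :> R.
  transitivity (('X^m * 'X^p * 'X^0 * 'X^q : {poly R})`_D).
    by rewrite expr0 mulr1 -!exprD coefXn eqxx.
  rewrite coefM4; do 3!apply: eq_bigr => ? _.
  by rewrite !coefXn.
have h (i : 'I_D.+1) (j : 'I_i.+1) (k : 'I_j.+1) :
    (k + (j - k) + (i - j) + (D - i))%N = D.
  by rewrite !subnKC // -ltnS.
pose F (i : 'I_D.+1) (j : 'I_i.+1) (k : 'I_j.+1) n :=
  residue_term_lim k (j - k)%N (i - j)%N (D - i)%N n - ((k : nat) == m)%:R
  * ((j - k)%N == p)%:R * ((i - j)%N == 0%N)%:R * ((D - i)%N == q)%:R * quad n.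
have gF : redseries e (fun n => \sum_(i < D.+1) \sum_(j < i.+1) \sum_(k < j.+1)
    F i j k n).
  by do 3!apply: redseries_sum => ?; apply: redseries_residue_term.
apply: (redseries_ext gF) => n; rewrite -[quad n]mul1r one /nat_residue_lim.
rewrite big_distrl -sumrB /=; apply: eq_bigr => i _.
rewrite big_distrl -sumrB /=; apply: eq_bigr => j _.
by rewrite big_distrl -sumrB.
Qed.

Definition neg_coef c r N n : R := - (-1) ^+ r * psum c r n
  + ((-1) ^+ r * psum c r (N + n) + reg R c r N).

Definition neg_coef_lim c r n : R := - (-1) ^+ r * psum c r n + zeta_lim R c r.

Lemma tame_neg_coef c r : (0 < r)%N -> tame (neg_coef c r) (neg_coef_lim c r).
Proof.
move=> r0; apply: tameD; last exact: tame_shift.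
by apply: tameZ; exact: tame_psum.
Qed.

Definition neg_residue N n : R := (-1) ^+ e * (-1) ^+ q *
  (neg_coef a m N n * neg_coef b p N n * weight q n).

Definition neg_residue_lim n : R := (-1) ^+ e * (-1) ^+ q *
  (neg_coef_lim a m n * neg_coef_lim b p n * weight q n).

(** At a negative integer [A], [B] and [1 / (s + 1/2)^q] are regular and [C] has
    a simple pole, so the residue is the product of the lowest coefficients. *)
Lemma kernel_neg N n : (n < N)%N ->
  (kernel D a b g m p q N (- n.+1%:R))`_D = sgn e n * neg_residue N n.
Proof.
move=> nN; set w : R := - n.+1%:R.
have la i : (i < m)%N -> (pole_kernel D a m N w)`_i = 0.
  by move=> im; rewrite coef_pole_kernel_neg // kappa_lt // mul0r mulr0.
have lb i : (i < p)%N -> (pole_kernel D b p N w)`_i = 0.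
  by move=> ip; rewrite coef_pole_kernel_neg // kappa_lt // mul0r mulr0.
have lh i : (i < q)%N -> (laurent D w (half R) ^+ q)`_i = 0.
  by move=> iq; rewrite coef_laurent_half_neg kappa_lt // mul0r.
have lg i : (i < 0)%N -> (two_sided_kernel D g N w)`_i = 0 by [].
have [lab ab] := coefM_low la lb.
have [labg abg] := coefM_low lab lg.
have [_ abgh] := coefM_low labg lh.
rewrite !addn0 in abg abgh.
rewrite /kernel abgh abg ab !coef_pole_kernel_neg //.
rewrite coef0_two_sided_kernel_neg //.
rewrite coef_laurent_half_neg !kappa_diag //.
rewrite -/(neg_coef a m N n) -/(neg_coef b p N n) /neg_residue.
transitivity ((-1) ^+ e * sgn e n * ((-1) ^+ q *
    (neg_coef a m N n * neg_coef b p N n * weight q n))); last by ring.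
by rewrite -sgnS -sgn_abg; ring.
Qed.

Lemma dominated_neg_residue : dominated neg_residue neg_residue_lim.
Proof.
have h := dominatedM q2 (tame_neg_coef a m0) (tame_neg_coef b p0)
  (tame_cst ((-1) ^+ e * (-1) ^+ q)).
have -> : neg_residue = (fun N n => neg_coef a m N n * neg_coef b p N n *
    ((-1) ^+ e * (-1) ^+ q) * weight q n).
  by apply: funext => N; apply: funext => n; rewrite /neg_residue; ring.
have -> : neg_residue_lim = (fun n => neg_coef_lim a m n * neg_coef_lim b p n *
    ((-1) ^+ e * (-1) ^+ q) * weight q n).
  by apply: funext => n; rewrite /neg_residue_lim; ring.
exact: h.
Qed.

(** The coefficient of [quad] is [(-1)^(e+q+m+p)], which is 1 since [e] is the
    parity of [m + p + q]. *)
Lemma redseries_neg_residue : redseries e (fun n => neg_residue_lim n - quad n).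
Proof.
have za := zeta_lim_red R a m0; have zb := zeta_lim_red R b p0.
have sr k : (-1) ^+ k \in reducibles R by rewrite rpredX ?rpredN1.
set s : R := (-1) ^+ e * (-1) ^+ q.
have s_red : s \in reducibles R by rewrite rpredM ?sr.
have sm : s * (-1) ^+ m * (-1) ^+ p = 1.
  rewrite /s /e signr_odd -!exprD /D.
  have -> : (m + p + q + q + m + p = (m + p + q) * 2)%N by lia.
  by rewrite exprM sqrr_sign.
have y_red : - (-1) ^+ p * zeta_lim R a m \in reducibles R.
  by rewrite rpredM ?rpredN ?sr.
have x_red : - (-1) ^+ m * zeta_lim R b p * s \in reducibles R.
  by rewrite rpredM // rpredM ?rpredN ?sr.
have g1 := redseries_affine e b (rpredM za zb) y_red s_red p0 q2.
have g2 := redseriesZ x_red (redseries_linear e a m0 q2).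
apply: (redseries_ext (redseriesD g1 g2)) => n.
have -> : quad n = s * (-1) ^+ m * (-1) ^+ p * quad n by rewrite sm mul1r.
by rewrite /neg_residue_lim /neg_coef_lim -/s /quad; ring.
Qed.

(** By Tannery's theorem the residues at the integers have a convergent sum,
    opposite to the limit of the residue at [- 1/2], hence reducible.  Up to
    reducible series, that sum is twice the series of [quad]. *)
Lemma redseries_quadratic : redseries e quad.
Proof.
have dom := dominatedD dominated_nat_residue dominated_neg_residue.
have [[C hC] lim_res] := dom.
pose T N n : R := sgn e n * (nat_residue N n + neg_residue N n).
pose t n : R := sgn e n * (nat_residue_lim n + neg_residue_lim n).
have hT N n : (n < N)%N ->
    `|T N n| <= (C *: (fun n => L n ^+ 3 * n.+1%:R^-1 ^+ 2)) n.
  by move=> nN; rewrite /T normrM norm_sgn mul1r; exact: hC.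
have Tt n : T N n @[N --> \oo] --> t n by apply: cvgMl_tmp; exact: lim_res.
have [ct lim_t] :=
  tannery hT Tt (is_cvg_seriesZ (k := C) (@cvg_harmonic_growth3 R)).
have [l l_red lim_l] := cvred_kernel_half D_gt0 a b g q D m0 p0.
have g_sum : redseries e (fun n => nat_residue_lim n + neg_residue_lim n).
  exists (- l); first by rewrite rpredN.
  suff <- : limn (series t) = - l by exact: ct.
  apply: (cvg_unique _ lim_t) => //=.
  have -> : (fun N => \sum_(0 <= n < N) T N n) =
      (fun N => - (kernel D a b g m p q N (half R))`_D).
    apply: funext => N; apply/eqP; rewrite -addr_eq0 addrC; apply/eqP.
    rewrite -[RHS](sum_kernel_residues R a b g N (erefl D) (ltnW q2)).
    congr (_ + _); rewrite big_nat_cond [RHS]big_nat_cond.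
    apply: eq_bigr => n; rewrite andbT => /andP[_ nN].
    by rewrite kernel_nat // kernel_neg // /T mulrDr.
  exact: cvgN.
have half_red : 2^-1 \in reducibles R.
  by have := reducibles_ratr R 2^-1; rewrite fmorphV rmorph_nat.
have mhalf_red : - 2^-1 \in reducibles R by rewrite rpredN.
apply: (redseries_ext (redseriesD (redseriesZ half_red g_sum)
  (redseriesZ mhalf_red
     (redseriesD redseries_nat_residue redseries_neg_residue)))) => n.
by rewrite -[RHS](mulKf (_ : 2 != 0)) ?pnatr_eq0 //; ring.
Qed.

End Quadratic.

Lemma redseries_Rsum_reducible e (f F : nat -> R) q (c : bool) :
    (forall n, Rterm f q n = (-1) ^+ c * (sgn e n * F n)) -> redseries e F ->
  Rsum_reducible f q.
Proof.
move=> fF [l l_red lim_l].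
have lim_f : series (Rterm f q) n @[n --> \oo] --> (-1) ^+ c * l.
  have -> : series (Rterm f q) =
      (fun N => (-1) ^+ c * series (fun n => sgn e n * F n) N).
    apply: funext => N; rewrite /series /= big_distrr /=.
    by apply: eq_bigr => n _; exact: fF.
  exact: cvgMl_tmp.
split; first by apply/cvg_ex; eexists; exact: lim_f.
have -> : Rsum f q = (-1) ^+ c * l by apply: cvg_lim.
by apply/reduciblesP; rewrite rpredM ?rpredX ?rpredN1.
Qed.

End Conclusion.

Theorem corollary3p5 (R : realType) (p m q : nat)
    (hp : (1 <= p)%N) (hm : (1 <= m)%N) (hq : (1 < q)%N) :
  (~~ odd (p + q + m) ->
    [/\ Rsum_reducible (fun n => H R m n * H R p n) q,
        Rsum_reducible (fun n => H R m n * Hbar R p n) q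
      & Rsum_reducible (fun n => Hbar R m n * Hbar R p n) q]) /\
  (odd (p + q + m) ->
    [/\ Rsum_reducible (fun n => H R m n * H R p n * (-1) ^+ n) q,
        Rsum_reducible (fun n => H R m n * Hbar R p n * (-1) ^+ n) q
      & Rsum_reducible (fun n => Hbar R m n * Hbar R p n * (-1) ^+ n) q]).
Proof.
have G a b := @redseries_quadratic R m p q a b hm hp hq.
have -> : (p + q + m)%N = (m + p + q)%N by rewrite addnC addnA.
split=> [/negbTE|] eD; rewrite eD in G; split.
- apply: (redseries_Rsum_reducible (c := false) _ (G false false)) => n.
  by rewrite /Rterm !H_psum sgn_false exprVn; ring.
- apply: (redseries_Rsum_reducible (c := true) _ (G false true)) => n.
  by rewrite /Rterm H_psum Hbar_psum sgn_false exprVn; ring.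
- apply: (redseries_Rsum_reducible (c := false) _ (G true true)) => n.
  by rewrite /Rterm !Hbar_psum sgn_false exprVn; ring.
- apply: (redseries_Rsum_reducible (c := false) _ (G false false)) => n.
  by rewrite /Rterm !H_psum sgn_true exprVn; ring.
- apply: (redseries_Rsum_reducible (c := true) _ (G false true)) => n.
  by rewrite /Rterm H_psum Hbar_psum sgn_true exprVn; ring.
- apply: (redseries_Rsum_reducible (c := false) _ (G true true)) => n.
  by rewrite /Rterm !Hbar_psum sgn_true exprVn; ring.
Qed.
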